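(* Let $n,m\ge1$ be integers, $0<\alpha<mn$, $1<p_i<\infty$ for $i=1,\dots,m$, $\frac1p=\frac1{p_1}+\cdots+\frac1{p_m}$, $\frac1m<p<\frac n\alpha$ and $\frac1q=\frac1p-\frac\alpha n$. For each $i=1,\dots,m$ let $X_i$ be a Banach function space on $\mathbb R^n$ such that $M_{X_i'}$ is bounded on $L^{p_i}(\mathbb R^n)$. Let $u$ and $v_1,\dots,v_m$ be weights satisfying $$K=\sup_Q\Big(\frac{u(Q)}{|Q|}\Big)^{1/q}\prod_{i=1}^m\|v_i^{-1}\|_{X_i,Q}<\infty,$$ the supremum being over all cubes $Q\subset\mathbb R^n$. Then for all $\vec f=(f_1,\dots,f_m)$, $$\|\mathcal M_\alpha(\vec f)\|_{L^q(u)}\le C\,K\prod_{i=1}^m\|M_{X_i'}\|_{L^{p_i}(\mathbb R^n)}\,\|f_i\|_{L^{p_i}(v_i^{p_i})},$$ where $\|M_{X_i'}\|_{L^{p_i}(\mathbb R^n)}$ is the operator norm of $M_{X_i'}$ on $L^{p_i}(\mathbb R^n)$ and $C$ does not depend on $\vec f$, $u$, $v_1,\dots,v_m$ or the spaces $X_i$.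
   Context: Cubes have sides parallel to the axes. A weight is a nonnegative locally integrable function, positive a.e.; $L^r(w)$ is taken with respect to $w\,dx$; $u(Q)=\int_Q u$. Multilinear fractional maximal operator: for $0\le\alpha<mn$, $$\mathcal M_\alpha(\vec f)(x)=\sup_{Q\ni x}\prod_{i=1}^m\frac1{|Q|^{1-\frac{\alpha}{mn}}}\int_Q|f_i(y_i)|\,dy_i,$$ the supremum over all cubes $Q\subset\mathbb R^n$ containing $x$. For a Banach function space $X$ on $\mathbb R^n$, the associate space $X'$ consists of the measurable $f$ with $\|f\|_{X'}=\sup_{\|g\|_X\le1}\int_{\mathbb R^n}|f(x)g(x)|\,dx<\infty$. For a cube $Q$ with side length $l(Q)$, the $X$-average of $f$ over $Q$ and the maximal operator $M_X$ are $$\|f\|_{X,Q}=\|\tau_{l(Q)}(f\chi_Q)\|_X,\qquad M_Xf(x)=\sup_{Q\ni x}\|f\|_{X,Q},$$ where $\tau_\delta f(x)=f(\delta x)$ for $\delta>0$, $x\in\mathbb R^n$. *)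

(* Defs.v *)
From HB Require Import structures.
From mathcomp Require Import all_boot all_order all_algebra.
From mathcomp Require Import all_classical all_reals all_analysis.
From mathcomp Require Import measurable_realfun.

Set Implicit Arguments.
Unset Strict Implicit.
Unset Printing Implicit Defensive.
Import Order.TTheory GRing.Theory Num.Theory.
Import numFieldNormedType.Exports.

Local Open Scope classical_set_scope.
Local Open Scope ring_scope.
Local Open Scope ereal_scope.

(** A cube is given by its lower corner and its side length. *)
Definition cube (R : realType) (n : nat) : choiceType :=
  ('rV[R]_n * {posnum R})%type.

Definition side (R : realType) (n : nat) (Q : cube R n) : R := Q.2%:num.

Definition cube_set (R : realType) (n : nat) (Q : cube R n) : set 'rV[R]_n :=
  [set x | forall i, (Q.1 ord0 i <= x ord0 i <= Q.1 ord0 i + side Q)%R].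

(** Lebesgue outer measure on R^n, by countable covers with cubes.  A cover may
    be finite, or even empty; this matters only when n = 0, where every cube
    has volume 1. *)
Definition lebesgue_outer (R : realType) (n : nat) (A : set 'rV[R]_n) : \bar R :=
  ereal_inf [set \esum_(Q in S) (side Q ^+ n)%:E | S in
    [set S : set (cube R n) |
      countable S /\ A `<=` \bigcup_(Q in S) cube_set Q]].

Section lebesgue_outer_measure.
Context (R : realType) (n : nat).
Local Notation lam := (@lebesgue_outer R n).
Local Notation vol := (fun Q : cube R n => (side Q ^+ n)%:E).

Let vol_ge0 (Q : cube R n) : 0 <= vol Q.
Proof. by rewrite lee_fin exprn_ge0 // /side. Qed.

Let lebesgue_outer_ge0 A : 0 <= lam A.
Proof. by apply: le_ereal_inf_tmp => _ [S _ <-]; apply: esum_ge0 => Q _. Qed.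

Let lebesgue_outer0 : lam set0 = 0.
Proof.
apply/eqP; rewrite eq_le lebesgue_outer_ge0 andbT.
by apply: ereal_inf_lbound; exists set0; [split | rewrite esum_set0].
Qed.

Let le_lebesgue_outer : {homo lam : A B / A `<=` B >-> A <= B}.
Proof.
move=> A B AB; apply/ereal_inf_le_tmp => _ [S [cS BS] <-].
by exists S => //; split => //; exact: subset_trans BS.
Qed.

Let lebesgue_outer_sigma_subadditive : sigma_subadditive lam.
Proof.
move=> A; have [[i ioo]|] := pselect (exists i, lam (A i) = +oo).
  rewrite (eseries_pinfty _ _ ioo) ?leey// => k _.
  by rewrite -ltNye (lt_le_trans _ (lebesgue_outer_ge0 _)).
rewrite -forallNE => Aoo.
suff add2e (e : {posnum R}) :
    lam (\bigcup_k A k) <= \sum_(i <oo) lam (A i) + e%:num%:E.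
  by apply/lee_addgt0Pr => _/posnumP[].
rewrite (le_trans _ (epsilon_trick _ _ _))//.
pose P k (S : set (cube R n)) :=
  [/\ countable S, A k `<=` \bigcup_(Q in S) cube_set Q &
    \esum_(Q in S) vol Q <= lam (A k) + (e%:num / (2 ^ k.+1)%:R)%:E].
have [S PS] : {S : (set (cube R n))^nat & forall k, P k (S k)}.
  apply: (@choice _ _ P) => k.
  have ek : (0 < e%:num / (2 ^ k.+1)%:R :> R)%R by [].
  have Afin : lam (A k) \is a fin_num.
    by rewrite ge0_fin_numE// ltey; apply/eqP; exact: Aoo.
  have [_ [S [cS AS] <-] /ltW leS] := lb_ereal_inf_adherent ek Afin.
  by exists S.
apply: (@le_trans _ _ (\esum_(Q in \bigcup_k S k) vol Q)).
  apply: ereal_inf_lbound; exists (\bigcup_k S k) => //; split.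
    by apply: bigcup_countable => // k _; have [] := PS k.
  move=> x [k _ Akx]; have [_ /(_ x Akx)[Q SQ Qx] _] := PS k.
  by exists Q => //; exists k.
rewrite seqDU_bigcup_eq (nneseries_sum_bigcup (@trivIset_seqDU _ S))//.
apply: lee_nneseries => [k _ _|k _]; first by apply: esum_ge0 => Q _; exact: vol_ge0.
have [_ _] := PS k; apply: le_trans; apply: le_ereal_sup.
by move=> _ [F [finF FS] <-]; exists F => //; split => // Q /FS; exact: subset_seqDU.
Qed.

HB.instance Definition _ := isOuterMeasure.Build R 'rV[R]_n lam
  lebesgue_outer0 lebesgue_outer_ge0 le_lebesgue_outer
  lebesgue_outer_sigma_subadditive.

End lebesgue_outer_measure.

Definition lebesgue_outer_measure (R : realType) (n : nat) :
  {outer_measure set 'rV[R]_n -> \bar R} := @lebesgue_outer R n.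

(** R^n with its sigma-algebra of Lebesgue (not only Borel) measurable sets. *)
Definition Rn (R : realType) (n : nat) : Type :=
  caratheodory_type (lebesgue_outer_measure R n).

HB.instance Definition _ (R : realType) (n : nat) := 
  Measurable.copy (Rn R n) (caratheodory_type (lebesgue_outer_measure R n)).

Definition leb (R : realType) (n : nat) : {measure set (Rn R n) -> \bar R} :=
  lebesgue_outer_measure R n : set (Rn R n) -> \bar R.

Section banach_function_spaces.
Context (R : realType) (n : nat).
Local Notation mu := (leb R n).
Implicit Types (f g : Rn R n -> \bar R) (E : set (Rn R n)).

(** The cone M^+ of measurable functions with values in [0, +oo]. *)
Definition Mplus f := measurable_fun setT f /\ forall x, 0 <= f x.

(** Banach function norms in the sense of Bennett and Sharpley; only the values
    of [rho] on M^+ matter. *)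
Record banach_function_norm (rho : (Rn R n -> \bar R) -> \bar R) : Prop :=
  BanachFunctionNorm {
    bfn_ge0 : forall f, Mplus f -> 0 <= rho f ;
    bfn_eq0 : forall f, Mplus f -> rho f = 0 <-> {ae mu, forall x, f x = 0} ;
    bfnZ : forall (a : R) f, (0 <= a)%R -> Mplus f ->
      rho (fun x => a%:E * f x) = a%:E * rho f ;
    bfnD : forall f g, Mplus f -> Mplus g ->
      rho (fun x => f x + g x) <= rho f + rho g ;
    bfn_le : forall f g, Mplus f -> Mplus g ->
      {ae mu, forall x, g x <= f x} -> rho g <= rho f ;
    bfn_fatou : forall (f_ : (Rn R n -> \bar R)^nat) f,
      (forall k, Mplus (f_ k)) -> Mplus f ->
      {ae mu, forall x, nondecreasing_seq (fun k => f_ k x) /\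
                        f_ k x @[k --> \oo] --> f x} ->
      rho (f_ k) @[k --> \oo] --> rho f ;
    bfn_indic : forall E, measurable E -> mu E < +oo ->
      rho (fun x => (\1_E x)%:E) < +oo ;
    bfn_integral : forall E, measurable E -> mu E < +oo ->
      exists2 C : R, (0 < C)%R &
        forall f, Mplus f -> \int[mu]_(x in E) f x <= C%:E * rho f }.

Record banach_function_space := BanachFunctionSpace {
  bfs_norm_plus :> (Rn R n -> \bar R) -> \bar R ;
  bfs_axioms : banach_function_norm bfs_norm_plus }.

Definition bfs_norm (X : banach_function_space) f : \bar R :=
  X (fun x => `|f x|).

(** The norm of the associate space X', equal to +oo off X'. *)
Definition associate_norm (X : banach_function_space) f : \bar R :=
  ereal_sup [set \int[mu]_x `|f x * g x| | g in
    [set g | measurable_fun setT g /\ bfs_norm X g <= 1]].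

Definition dilation (delta : R) f : Rn R n -> \bar R :=
  fun x => f (delta *: (x : 'rV[R]_n))%R.

(** [N] stands for the norm of X or of X'. *)
Definition norm_average (N : (Rn R n -> \bar R) -> \bar R) (Q : cube R n) f :
    \bar R :=
  N (dilation (side Q) (fun x => f x * (\1_(cube_set Q) x)%:E)).

Definition norm_maximal (N : (Rn R n -> \bar R) -> \bar R) f :
    Rn R n -> \bar R :=
  fun x => ereal_sup [set norm_average N Q f | Q in [set Q | cube_set Q x]].

End banach_function_spaces.

Section Lp_operators.
Context (R : realType) (n : nat).
Local Notation mu := (leb R n).
Implicit Types (T : (Rn R n -> \bar R) -> Rn R n -> \bar R).

Definition Lp_bounded (p : R) T := exists C : R,
  forall f, measurable_fun setT f -> 'N[mu]_p%:E[f] < +oo ->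
    'N[mu]_p%:E[T f] <= C%:E * 'N[mu]_p%:E[f].

Definition Lp_opnorm (p : R) T : \bar R :=
  ereal_sup [set 'N[mu]_p%:E[T f] | f in
    [set f | measurable_fun setT f /\ 'N[mu]_p%:E[f] <= 1]].

End Lp_operators.

Section weights.
Context (R : realType) (n : nat).
Local Notation mu := (leb R n).
Implicit Types (w : Rn R n -> R).

Record weight w : Prop := Weight {
  weight_measurable : measurable_fun setT w ;
  weight_ge0 : forall x, (0 <= w x)%R ;
  weight_locally_integrable : forall K : set 'rV[R]_n, compact K ->
    \int[mu]_(x in K) (w x)%:E < +oo ;
  weight_gt0 : {ae mu, forall x, (0 < w x)%R} }.

(** The norm of L^r(w), for the measure w dx. *)
Definition weighted_Lnorm (r : R) w (f : Rn R n -> \bar R) : \bar R :=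
  (\int[mu]_x (`|f x| `^ r * (w x)%:E)) `^ r^-1.

End weights.

Section multilinear.
Context (R : realType) (n m : nat).
Local Notation mu := (leb R n).

Definition fractional_maximal (alpha : R) (f : 'I_m -> Rn R n -> \bar R) :
    Rn R n -> \bar R :=
  fun x => ereal_sup
    [set \prod_(i < m) ((mu (cube_set Q) `^ (1 - alpha / (m * n)%:R))^-1 *
                        \int[mu]_(y in cube_set Q) `|f i y|)
    | Q in [set Q | cube_set Q x]].

(** v^-1 is taken in the extended reals, so it is +oo where v vanishes. *)
Definition weight_constant (q : R) (X : 'I_m -> banach_function_space R n)
    (u : Rn R n -> R) (v : 'I_m -> Rn R n -> R) : \bar R :=
  ereal_sup [set
    ((\int[mu]_(x in cube_set Q) (u x)%:E) / mu (cube_set Q)) `^ q^-1 *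
    \prod_(i < m) norm_average (bfs_norm (X i)) Q (fun x => (v i x)%:E^-1)
    | Q in [set: cube R n]].

End multilinear.

(* Main.v *)
From HB Require Import structures.
Require Import Defs.
From mathcomp Require Import all_boot all_order all_algebra.
From mathcomp Require Import all_classical all_reals all_analysis.
From mathcomp Require Import measurable_realfun.
From mathcomp Require Import ring lra.
Import Order.TTheory GRing.Theory Num.Theory.
Import numFieldNormedType.Exports.
Local Open Scope classical_set_scope.
Local Open Scope ring_scope.

(** As [alpha > 0], the exponent [s = q / p] exceeds [1].  This gap is
    what makes the sum over all cubes of a grid, at all scales, converge.

    For a dyadic scale [t] let [P] be the closed cube of side [3 t] concentric
    with the half-open grid cell of side [t] that contains [x].  A cube [Q]
    through [x] with [side Q <= t <= 2 * side Q] lies in [P], and the volumes of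
    [P] and [Q] are comparable, so the [q]-th power of the maximal function at
    [x] is at most a constant times the sum, over all scales, of the [q]-th
    powers of the averages over the cubes [P] ([fractional_maximal_le_grid]).

    Let [c i] be the average of [f i * v i] over [P] for the norm of [X'] and
    [d i] the average of [1 / v i] for the norm of [X].  Dilating [P] to side 1
    turns the duality of [X] and [X'] into
    [integral of |f i| over P <= |P| * c i * d i]
    ([associate_hoelder_average]).  By the definition of the weight
    constant [K] and by
    [1 / q + alpha / n = 1 / p], the average over [P], raised to the power [q]
    and multiplied by [u(P)], is then at most
    [K ^ q * |P| ^ s * (\prod_i c i) ^ q] ([frac_average_testing]).

    On its cell, [c i] is bounded by the supremum [grid_maximal] of such
    averages over all scales, a measurable function below the maximal operator
    of [X'].  Let [B i] be the operator norm times the norm of [f i * v i].  By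
    the weighted AM-GM inequality there is one function [H], of integral at most
    [1], with [\prod_i (c i / B i) ^ p <= H] on every cell of every scale
    ([grid_average_majorant]).  Averaging over the cell, the same product is also
    [O(1 / |P|)].  What remains is the pointwise inequality
    [\sum_P |P| ^ (s - 1) * Num.min H (1 / |P|) ^ s <= C * H],
    where [P] runs through the cubes at [x], one for each scale.  It is a
    two-sided geometric series, since the terms grow until [|P| = 1 / H] and
    decay afterwards ([hedberg_sum]).  Integrating it gives the theorem
    ([grid_packing]).

    Integrals of nonnegative functions are suprema over the simple functions
    below them, hence monotone for arbitrary functions.  This allows the
    comparison of the maximal operators, suprema over uncountably many cubes,
    with their measurable counterparts on the grid. *)

(** * Lebesgue measure of cubes and dilations *)

(** Boxes weighted by [w] that cover another box have at least its volume.  The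
    induction peels off one coordinate: on each slice [x ord0 = t] the hypothesis
    is again a cover, with the weights multiplied by the indicators of the
    intervals of the first coordinate, and the slice estimates are integrated in
    [t] for the one-dimensional Lebesgue measure.  Monotone convergence takes
    care of countable covers. *)
Lemma box_volume_le_series (R : realType) (n : nat) (a b : 'I_n -> R)
    (c d : nat -> 'I_n -> R) (w : nat -> R) :
  (forall i, a i <= b i) -> (forall j i, c j i <= d j i) ->
  (forall j, 0 <= w j) ->
  (forall x : 'I_n -> R, ((\prod_i \1_`[a i, b i] (x i))%:E <=
     \sum_(0 <= j <oo) (w j * \prod_i \1_`[c j i, d j i] (x i))%:E)%E) ->
  ((\prod_i (b i - a i))%:E <=
     \sum_(0 <= j <oo) (w j * \prod_i (d j i - c j i))%:E)%E.
Proof.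
elim: n a b c d w => [|n IHn] a b c d w ab cd w0 cover.
  have := cover (fun=> 0); rewrite !big_ord0 => /le_trans; apply.
  by apply: lee_nneseries => [j _ _|j _]; rewrite !big_ord0 // lee_fin mulr1.
pose V := \prod_(i < n) (b (lift ord0 i) - a (lift ord0 i)).
pose W j := \prod_(i < n) (d j (lift ord0 i) - c j (lift ord0 i)).
have V0 : 0 <= V by apply: prodr_ge0 => i _; rewrite subr_ge0.
have W0 j : 0 <= W j by apply: prodr_ge0 => i _; rewrite subr_ge0.
have slice (t : R) : ((V * \1_`[a ord0, b ord0] t)%:E <=
    \sum_(0 <= j <oo) (w j * W j * \1_`[c j ord0, d j ord0] t)%:E)%E.
  have [tab|tab] := pselect (`[a ord0, b ord0]%classic t); last first.
    rewrite indicE memNset// mulr0; apply: nneseries_ge0 => j _ _.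
    by rewrite lee_fin !mulr_ge0.
  rewrite [X in (V * X)]indicE mem_set// mulr1.
  apply: (@le_trans _ _ (\sum_(0 <= j <oo)
      (w j * \1_`[c j ord0, d j ord0] t * W j)%:E)%E); last first.
    by apply: lee_nneseries => [j _ _|j _]; rewrite lee_fin ?mulr_ge0// mulrAC.
  apply: (IHn (a \o lift ord0) (b \o lift ord0) (fun j => c j \o lift ord0)
    (fun j => d j \o lift ord0)) => [i|j i|j|x]; rewrite /= ?mulr_ge0//.
  (* the point of the slice at [t] with the other coordinates given by [x] *)
  pose y i := if unlift ord0 i is Some k then x k else t.
  have prodE (F : 'I_n.+1 -> R -> R) :
      \prod_i F i (y i) = F ord0 t * \prod_i F (lift ord0 i) (x i).
    rewrite big_ord_recl /y unlift_none; congr (_ * _).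
    by apply: eq_bigr => i _; rewrite liftK.
  have := cover y; rewrite (prodE (fun i => \1_`[a i, b i])).
  rewrite [X in (X * _)]indicE mem_set// mul1r => /le_trans; apply.
  apply: lee_nneseries => [j _ _|j _].
    by rewrite lee_fin mulr_ge0// prodr_ge0// => i _; rewrite indicE ler0n.
  by rewrite (prodE (fun i => \1_`[c j i, d j i])) mulrA.
rewrite big_ord_recl -/V.
have intI (k p r : R) : 0 <= k -> p <= r ->
    (\int[lebesgue_measure]_t (k * \1_`[p, r] t)%:E = (k * (r - p))%:E)%E.
  move=> k0 pr; under eq_integral do rewrite EFinM.
  rewrite ge0_integralZl//=; last first.
    by apply/measurable_EFinP; exact: measurable_indic.
  rewrite integral_indic// setIT EFinM; congr (_ * _)%E.
  apply: (etrans (lebesgue_measure_itv `[p, r]%R)); rewrite /= lte_fin.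
  by move: pr; rewrite le_eqVlt => /predU1P[->|->]//; rewrite ltxx subrr.
rewrite mulrC -intI//.
apply: (@le_trans _ _ (\int[lebesgue_measure]_t \sum_(0 <= j <oo)
    (w j * W j * \1_`[c j ord0, d j ord0] t)%:E)%E).
  apply: ge0_le_integral => //.
  - by move=> t _; rewrite lee_fin mulr_ge0.
  - apply/measurable_EFinP; apply: measurable_funM => //.
  - apply: ge0_emeasurable_sum => j *; first by rewrite lee_fin !mulr_ge0.
    by apply/measurable_EFinP; apply: measurable_funM => //; exact: measurable_indic.
rewrite integral_nneseries//; last 2 first.
- move=> j; apply/measurable_EFinP; apply: measurable_funM => //; exact: measurable_indic.
- by move=> j t _; rewrite lee_fin !mulr_ge0.
apply: lee_nneseries => [j _ _|j _].
  by apply: integral_ge0 => t _; rewrite lee_fin !mulr_ge0.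
by rewrite intI ?mulr_ge0// big_ord_recl -/(W j) lee_fin -mulrA (mulrC (W j)).
Qed.

(** The set [B] of indices allows for finite and empty covers. *)
Lemma countable_cover_seq {R : realType} {n : nat} (S : set (cube R n)) :
  countable S -> exists (e : nat -> cube R n) (B : set nat),
    S = e @` B /\ forall a : cube R n -> \bar R, (forall Q, 0 <= a Q)%E ->
      \esum_(Q in S) a Q = (\sum_(0 <= j <oo) if j \in B then a (e j) else 0)%E.
Proof.
move=> cS; have [->|/set0P[Q0 SQ0]] := eqVneq S set0.
  exists (fun=> (0, 1%:pos)), set0; rewrite image_set0; split=> // a a0.
  by rewrite esum_set0 eseries0// => j _ _; rewrite in_set0.
have /countable_injP[f finj] := cS.
pose e j := xget Q0 [set Q | S Q /\ f Q = j].
have ef Q : S Q -> e (f Q) = Q.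
  move=> SQ; rewrite /e; case: xgetP => [Q' _ [SQ' ff]|/(_ Q)[]//].
  by apply: finj; rewrite ?inE.
exists e, (f @` S); split=> [|a a0].
  rewrite image_comp; apply/seteqP; split=> [Q SQ|_ [Q SQ <-]] /=; last by rewrite ef.
  by exists Q => //=; rewrite ef.
rewrite nneseries_esumT => [|j]; last by case: ifP.
rewrite -esum_mkcond esum_image//; apply: eq_esum => Q SQ.
by rewrite ef.
Qed.

Lemma lebesgue_outer_cube_le {R : realType} {n : nat} (Q : cube R n) :
  (lebesgue_outer_measure R n (cube_set Q) <= (side Q ^+ n)%:E)%E.
Proof.
apply: ereal_inf_lbound; exists [set Q]; first by split=> //; rewrite bigcup_set1.
by rewrite esum_set1// lee_fin exprn_ge0 // /side.
Qed.

Lemma lebesgue_outer_cubes_le {R : realType} {n : nat} (s : seq (cube R n))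
    (A : set 'rV[R]_n) :
  (forall x, A x -> exists2 Q, Q \in s & cube_set Q x) ->
  (lebesgue_outer_measure R n A <= (\sum_(Q <- s) side Q ^+ n)%:E)%E.
Proof.
elim: s A => [|Q s IHs] A As.
  suff -> : A = set0 by rewrite outer_measure0 big_nil.
  by apply/seteqP; split=> // x /As[].
have /le_outer_measure /le_trans : A `<=` cube_set Q `|`
    [set x | exists2 Q, Q \in s & cube_set Q x].
  move=> x /As[Q']; rewrite inE => /predU1P[->|Q's] Qx; first by left.
  by right; exists Q'.
apply; apply: le_trans (outer_measureU2 _ _ _) _.
by rewrite big_cons EFinD leeD// ?lebesgue_outer_cube_le// IHs.
Qed.

Lemma grid_index {R : realType} {N : nat} (h t : R) : 0 < h ->
  0 <= t <= N.+1%:R * h -> exists j : 'I_N.+1, j%:R * h <= t <= j%:R * h + h.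
Proof.
move=> h0 /andP[t0 tN].
have hS k : k%:R * h + h = k.+1%:R * h by rewrite -natr1 mulrDl mul1r.
have [tltN|tgeN] := ltP t (N.+1%:R * h); last first.
  exists ord_max; have -> : t = N.+1%:R * h by apply/eqP; rewrite eq_le tN.
  by rewrite /= hS lexx ler_pM2r// ler_nat leqnSn.
have /truncn_itv/andP[] : 0 <= t / h by rewrite divr_ge0// ltW.
set k := Num.trunc _; rewrite ler_pdivlMr// ltr_pdivrMr// => kt tk.
have kN : (k < N.+1)%N.
  by rewrite -(ltr_nat R) -(ltr_pM2r h0); exact: le_lt_trans tltN.
by exists (Ordinal kN); rewrite kt/= hS ltW.
Qed.

Lemma card_ffun_slice {n N : nat} (i0 : 'I_n) (A : {set 'I_N}) :
  (#|[set f : {ffun 'I_n -> 'I_N} | f i0 \in A]%SET| = #|A| * N ^ n.-1)%N.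
Proof.
pose F i := if i == i0 then [pred j | j \in A] else predT.
have -> : #|[set f : {ffun 'I_n -> 'I_N} | f i0 \in A]%SET| = #|family F|.
  apply: eq_card => f; rewrite !inE; apply/idP/familyP => [fA i|/(_ i0)]; rewrite /F.
    by case: eqP => [->|_]; rewrite ?inE.
  by rewrite eqxx inE.
rewrite card_family foldrE big_map big_enum/= (bigD1 i0)//= {1}/F eqxx.
congr (_ * _)%N.
rewrite (eq_bigr (fun=> N)); last first.
  by move=> i /negbTE ni; rewrite /F ni -[RHS]card_ord; apply: eq_card.
by rewrite prod_nat_const cardC1 card_ord.
Qed.

(** Cut [Q] into [N.+1 ^ n] equal subcubes.  At most one of the [N.+1] slabs
    orthogonal to the coordinate [i0] meets both the half-space and its
    complement, so the subcubes meeting the one and those meeting the other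
    have together at most [1 + 1 / N.+1] times the volume of [Q]. *)
Lemma lebesgue_outer_halfspace_cube {R : realType} {n : nat} (i0 : 'I_n)
    (T : set R) (Q : cube R n) :
  (forall s t, s <= t -> T t -> T s) ->
  (lebesgue_outer_measure R n (cube_set Q `&` [set x : 'rV_n | T (x ord0 i0)]) +
   lebesgue_outer_measure R n (cube_set Q `&` ~` [set x : 'rV_n | T (x ord0 i0)]) <=
   (side Q ^+ n)%:E)%E.
Proof.
move=> Tdown; set H := [set x | _]; have n0 : (0 < n)%N by apply: leq_ltn_trans (ltn_ord i0).
have l0 : 0 < side Q by rewrite /side.
suff bound N : (lebesgue_outer_measure R n (cube_set Q `&` H) +
    lebesgue_outer_measure R n (cube_set Q `&` ~` H)
    <= (side Q ^+ n)%:E + (side Q ^+ n / N.+1%:R)%:E)%E.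
  apply/lee_addgt0Pr => e e0.
  apply: le_trans (bound (Num.trunc (side Q ^+ n / e))) _.
  rewrite leeD2l// lee_fin ler_pdivrMr// mulrC -ler_pdivrMr//.
  by apply/ltW; have /truncn_itv/andP[] : 0 <= side Q ^+ n / e
    by rewrite divr_ge0 ?exprn_ge0// ltW.
have [h hN] : exists h : {posnum R}, side Q = N.+1%:R * h%:num.
  have lN0 : 0 < side Q / N.+1%:R by rewrite divr_gt0.
  by exists (PosNum lN0); rewrite /= mulrC divfK.
pose sub (f : {ffun 'I_n -> 'I_N.+1}) : cube R n :=
  (\row_i (Q.1 ord0 i + (f i)%:R * h%:num), h).
have cover x : cube_set Q x -> exists f, cube_set (sub f) x.
  move=> Qx; have /fin_all_exists[g gP] i : exists j : 'I_N.+1,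
      j%:R * h%:num <= x ord0 i - Q.1 ord0 i <= j%:R * h%:num + h%:num.
    by apply: grid_index => //; rewrite subr_ge0 lerBlDl -hN; exact: Qx.
  exists [ffun i => g i] => i; rewrite mxE ffunE /side/=.
  by have := gP i; rewrite lerBrDl lerBlDl addrA.
pose A := [set j : 'I_N.+1 | `[< exists2 t, T t &
   Q.1 ord0 i0 + j%:R * h%:num <= t <= Q.1 ord0 i0 + j%:R * h%:num + h%:num >]]%SET.
pose B := [set j : 'I_N.+1 | `[< exists2 t, ~ T t &
   Q.1 ord0 i0 + j%:R * h%:num <= t <= Q.1 ord0 i0 + j%:R * h%:num + h%:num >]]%SET.
have AB : (#|A| + #|B| <= N.+2)%N.
  rewrite -cardsUI -[leqRHS]addn1 leq_add//.
    by rewrite (leq_trans (max_card _))// card_ord.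
  (* no slab above one that meets the complement of [T] meets [T] *)
  suff lt_absurd (j j' : 'I_N.+1) : (j < j')%N -> j \in B -> j' \in A -> False.
    apply/card_le1_eqP => j j' /setIP[jA jB] /setIP[j'A j'B].
    apply/val_inj; case: (ltngtP j j') => // jj'.
      by have := lt_absurd _ _ jj' jB j'A.
    by have := lt_absurd _ _ jj' j'B jA.
  move=> jj' jB j'A; move: jB j'A; rewrite 2!finset.inE.
  move=> /asboolP[t Tt /andP[_ tj]] /asboolP[s Ts /andP[js _]].
  apply/Tt/(Tdown _ s) => //; apply: le_trans tj _; apply: le_trans js.
  rewrite -addrA lerD2l (_ : _ + _ = j.+1%:R * h%:num); last first.
    by rewrite -natr1 mulrDl mul1r.
  by rewrite ler_pM2r// ler_nat.
have bound (C : {set 'I_N.+1}) (K : set 'rV[R]_n) :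
    (forall x f, K x -> cube_set (sub f) x -> f i0 \in C) ->
    (lebesgue_outer_measure R n (cube_set Q `&` K) <=
      ((#|C| * N.+1 ^ n.-1)%:R * h%:num ^+ n)%:E)%E.
  move=> KC; rewrite -(card_ffun_slice i0) mulr_natl.
  have := lebesgue_outer_cubes_le
    [seq sub f | f <- enum [set f : {ffun 'I_n -> 'I_N.+1} | f i0 \in C]%SET]
    (cube_set Q `&` K).
  rewrite big_map big_enum/= (eq_bigr (fun=> h%:num ^+ n))//.
  rewrite sumr_const; apply => x [Qx Kx].
  have [f fx] := cover x Qx; exists (sub f) => //.
  by apply: map_f; rewrite mem_enum inE; exact: KC fx.
have boundA := bound A H; have boundB := bound B (~` H).
apply: le_trans (leeD (boundA _) (boundB _)) _.
- move=> x f Hx /(_ i0); rewrite mxE => fx.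
  by rewrite inE; apply/asboolP; exists (x ord0 i0).
- move=> x f Hx /(_ i0); rewrite mxE => fx.
  by rewrite inE; apply/asboolP; exists (x ord0 i0).
rewrite -!EFinD lee_fin -mulrDl -natrD -mulnDl.
have hn : side Q ^+ n = N.+1%:R ^+ n * h%:num ^+ n by rewrite {1}hN exprMn.
have -> : side Q ^+ n + side Q ^+ n / N.+1%:R =
    (N.+2 * N.+1 ^ n.-1)%:R * h%:num ^+ n.
  have Mn : N.+1%:R ^+ n = N.+1%:R * N.+1%:R ^+ n.-1 :> R by rewrite -exprS prednK.
  have M2 : N.+2%:R = N.+1%:R + 1 :> R by rewrite natr1.
  have M0 : N.+1%:R != 0 :> R by rewrite pnatr_eq0.
  by rewrite hn Mn natrM natrX M2; field.
by rewrite ler_wpM2r ?exprn_ge0// ler_nat leq_mul2r AB orbT.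
Qed.

Lemma nneseries_ge_term {R : realType} (u : nat -> \bar R) (k : nat) :
  (forall j, 0 <= u j)%E -> (u k <= \sum_(0 <= j <oo) u j)%E.
Proof.
move=> u0; apply: le_trans (nneseries_lim_ge k.+1 (fun j _ _ => u0 j)).
by rewrite big_nat_recr//= leeDr// sume_ge0.
Qed.

(** The outer measure is an infimum over covers by cubes, so the criterion of
    Caratheodory only has to be checked on each cube of a cover. *)
Lemma measurable_halfspace {R : realType} {n : nat} (i : 'I_n) (T : set R) :
  (forall s t, s <= t -> T t -> T s) ->
  measurable ([set x | T ((x : 'rV[R]_n) ord0 i)] : set (Rn R n)).
Proof.
move=> Tdown; set H : set 'rV[R]_n := [set x | _].
apply: (@le_caratheodory_measurable _ _ (lebesgue_outer_measure R n)) => X.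
apply: le_ereal_inf_tmp => _ [S [cS XS] <-].
have [e [B [SE ->]]] := countable_cover_seq S cS; last first.
  by move=> Q; rewrite lee_fin exprn_ge0// /side.
have cover K : (lebesgue_outer_measure R n (X `&` K) <= \sum_(0 <= j <oo)
    if j \in B then lebesgue_outer_measure R n (cube_set (e j) `&` K) else 0)%E.
  pose F j := if j \in B then cube_set (e j) `&` K else set0.
  have /(le_outer_measure (lebesgue_outer_measure R n)) : X `&` K `<=` \bigcup_j F j.
    move=> x [/XS[_ /[!SE] -[j Bj <-] Qx] Kx]; exists j => //.
    by rewrite /F mem_set.
  move=> /le_trans; apply; apply: le_trans (outer_measure_sigma_subadditive _ _) _.
  by apply: lee_nneseries => // j _; rewrite /F; case: ifPn => // _; rewrite outer_measure0.
apply: le_trans (leeD (cover _) (cover _)) _.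
rewrite -nneseriesD => [|j _ _|j _ _]; [|by case: ifP..].
apply: lee_nneseries => [j _ _|j _]; case: ifP => // _; rewrite ?adde_ge0 ?adde0//.
exact: lebesgue_outer_halfspace_cube.
Qed.

Lemma measurable_coord_itv {R : realType} {n : nat} (i : 'I_n) (I : interval R) :
  measurable ([set x | (x : 'rV[R]_n) ord0 i \in I] : set (Rn R n)).
Proof.
case: I => a b.
have mlt (c : itv_bound R) : measurable
    ([set x | (BRight ((x : 'rV[R]_n) ord0 i) <= c)%O] : set (Rn R n)).
  by apply: (measurable_halfspace i [set t | (BRight t <= c)%O]) => s t st /=;
    apply: le_trans.
have mle (c : itv_bound R) : measurable
    ([set x | (c <= BLeft ((x : 'rV[R]_n) ord0 i))%O] : set (Rn R n)).
  rewrite (_ : [set x | _] = ~` [set x : Rn R n | (BLeft ((x : 'rV[R]_n) ord0 i) < c)%O]).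
    apply: measurableC.
    apply: (measurable_halfspace i [set t | (BLeft t < c)%O]) => s t st /=.
    exact: le_lt_trans.
  by apply/seteqP; split=> x /=; rewrite leNgt => /negP.
rewrite (_ : [set x | _] = [set x : Rn R n | (a <= BLeft ((x : 'rV[R]_n) ord0 i))%O] `&`
    [set x | (BRight ((x : 'rV[R]_n) ord0 i) <= b)%O]); first exact: measurableI.
by apply/seteqP; split=> x /=; rewrite itv_boundlr => /andP.
Qed.

Lemma measurable_box {R : realType} {n : nat} (I : 'I_n -> interval R) :
  measurable ([set x | forall i, (x : 'rV[R]_n) ord0 i \in I i] : set (Rn R n)).
Proof.
rewrite (_ : [set x | _] = \bigcap_(i in [set: 'I_n])
    [set x : Rn R n | (x : 'rV[R]_n) ord0 i \in I i]).
  by apply: fin_bigcap_measurable => // i _; exact: measurable_coord_itv.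
by apply/seteqP; split=> [x xI i _|x xI i]; [exact: xI|exact: (xI i)].
Qed.

Lemma measurable_cube {R : realType} {n : nat} (Q : cube R n) :
  measurable (cube_set Q : set (Rn R n)).
Proof.
rewrite (_ : cube_set Q = [set x | forall i, (x : 'rV[R]_n) ord0 i \in
  `[Q.1 ord0 i, Q.1 ord0 i + side Q]]); first exact: measurable_box.
by apply/seteqP; split=> x Qx i; have := Qx i; rewrite in_itv.
Qed.

(** The cover of [Q] by itself gives one inequality, [box_volume_le_series] the
    other. *)
Lemma leb_cube {R : realType} {n : nat} (Q : cube R n) :
  leb R n (cube_set Q) = (side Q ^+ n)%:E.
Proof.
apply/eqP; rewrite eq_le lebesgue_outer_cube_le/=.
apply: le_ereal_inf_tmp => _ [S [cS QS] <-].
have [e [B [SE ->]]] := countable_cover_seq S cS; last first.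
  by move=> Q'; rewrite lee_fin exprn_ge0// /side.
have volE (Q' : cube R n) : side Q' ^+ n =
    \prod_(i < n) (Q'.1 ord0 i + side Q' - Q'.1 ord0 i).
  rewrite (eq_bigr (fun=> side Q')) => [|i _]; last by rewrite addrC addKr.
  by rewrite prodr_const card_ord.
have side0 (Q' : cube R n) : 0 <= side Q' by rewrite /side.
rewrite volE (eq_eseriesr (g := fun j => ((\1_B j) * \prod_(i < n)
    ((e j).1 ord0 i + side (e j) - (e j).1 ord0 i))%:E)); last first.
  by move=> j _; rewrite indicE -volE; case: ifP => _; rewrite ?mul1r ?mul0r.
apply: box_volume_le_series => [i|j i|j|x]; rewrite ?lerDl//.
have [xQ|/existsNP[i xQi]] := pselect (cube_set Q (\row_i x i)); last first.
  rewrite (bigD1 i)//= indicE memNset ?mul0r.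
    apply: nneseries_ge0 => j _ _; rewrite lee_fin mulr_ge0//.
    by apply: prodr_ge0 => k _; rewrite indicE ler0n.
  by rewrite /= in_itv/=; move: xQi; rewrite mxE.
have [_ /[!SE] -[j Bj <-] Qx] := QS _ xQ.
apply: le_trans (nneseries_ge_term _ j _); last first.
  by move=> k; rewrite lee_fin mulr_ge0//; apply: prodr_ge0 => ? _; rewrite indicE ler0n.
rewrite lee_fin indicE mem_set// mul1r [leRHS]big1 => [|i _].
  by apply: prodr_ile1 => i _; rewrite indicE ler0n lern1 leq_b1.
by rewrite indicE mem_set//= in_itv/=; have := Qx i; rewrite mxE.
Qed.

(** Scaling a cover of [A] by [1 / d] covers the scaled set.  Applied to [d] and
    to [1 / d], this gives the equality [lebesgue_outer_dilation]. *)
Lemma lebesgue_outer_dilation_le {R : realType} {n : nat} (d : R)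
    (A : set 'rV[R]_n) : 0 < d ->
  ((d ^+ n)%:E * lebesgue_outer_measure R n [set x | A (d *: x)] <=
    lebesgue_outer_measure R n A)%E.
Proof.
move=> d0; apply: le_ereal_inf_tmp => _ [S [cS AS] <-].
have [e [B [SE ->]]] := countable_cover_seq S cS; last first.
  by move=> Q'; rewrite lee_fin exprn_ge0// /side.
have r0 (Q : cube R n) : 0 < side Q / d by rewrite divr_gt0// /side.
pose phi (Q : cube R n) : cube R n := (d^-1 *: Q.1, PosNum (r0 Q)).
pose F j := if j \in B then cube_set (phi (e j)) else set0.
have /(le_outer_measure (lebesgue_outer_measure R n)) :
    [set x | A (d *: x)] `<=` \bigcup_j F j.
  move=> x /AS[_ /[!SE] -[j Bj <-] Qx]; exists j => //.
  rewrite /F mem_set// => i; have := Qx i; rewrite !mxE /side/=.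
  move=> /andP[lx xr].
  by rewrite ler_pdivrMl// lx [_.2%:num / d]mulrC -mulrDr ler_pdivlMl.
rewrite -lee_pdivlMl ?exprn_gt0// -nneseriesZl => [/le_trans|j _]; last first.
  by case: ifP => //; rewrite lee_fin exprn_ge0// /side.
apply; apply: le_trans (outer_measure_sigma_subadditive _ _) _.
apply: lee_nneseries => // j _; rewrite /F; case: ifP => _; last first.
  by rewrite outer_measure0 mule0.
apply: le_trans (lebesgue_outer_cube_le _) _.
by rewrite /phi /side/= lee_fin exprMn exprVn mulrC.
Qed.

Lemma lebesgue_outer_dilation {R : realType} {n : nat} (d : R)
    (A : set 'rV[R]_n) : 0 < d ->
  lebesgue_outer_measure R n A =
  ((d ^+ n)%:E * lebesgue_outer_measure R n [set x | A (d *: x)])%E.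
Proof.
move=> d0; apply/eqP; rewrite eq_le lebesgue_outer_dilation_le// andbT.
have di0 : 0 < d^-1 by rewrite invr_gt0.
have := lebesgue_outer_dilation_le d^-1 [set x | A (d *: x)] di0.
rewrite exprVn lee_pdivrMl ?exprn_gt0//; congr (lebesgue_outer _ <= _)%E.
by apply/seteqP; split=> x /=; rewrite scalerA divff ?gt_eqF// scale1r.
Qed.

(** The criterion of Caratheodory is invariant under dilations, because they
    multiply the outer measure of all sets by the same factor. *)
Lemma measurable_dilate {R : realType} {n : nat} (d : R) : 0 < d ->
  measurable_fun [set: Rn R n] (fun x => d *: (x : 'rV[R]_n) : Rn R n).
Proof.
move=> d0 _ A mA; rewrite setTI.
have cA : (lebesgue_outer_measure R n).-caratheodory A := mA.
suff : (lebesgue_outer_measure R n).-caratheodory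
  ((fun x : 'rV[R]_n => d *: x) @^-1` A) by [].
move=> X; have := cA [set x : 'rV[R]_n | X (d^-1 *: x)].
set Y := [set x | _] => YA.
have -> : X = [set x | Y (d *: x)].
  by apply/seteqP; split=> x; rewrite /Y/= scalerA mulVf ?gt_eqF// scale1r.
have dnE (a b : \bar R) : ((d ^+ n)%:E * a = (d ^+ n)%:E * b -> a = b)%E.
  have dn0 : d ^+ n != 0 by rewrite gt_eqF ?exprn_gt0.
  by move/(congr1 (mule (d ^+ n)^-1%:E)); rewrite !muleA -EFinM mulVf// !mul1e.
apply: dnE; rewrite ge0_muleDr ?outer_measure_ge0//.
rewrite -lebesgue_outer_dilation// YA.
by congr (_ + _)%E; rewrite (lebesgue_outer_dilation d)//; congr (_ * lebesgue_outer _)%E.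
Qed.

Lemma ge0_integral_dilation {R : realType} {n : nat} (d : R)
    (f : Rn R n -> \bar R) : 0 < d ->
  measurable_fun setT f -> (forall x, 0 <= f x)%E ->
  (\int[leb R n]_x f x = (d ^+ n)%:E * \int[leb R n]_x dilation d f x)%E.
Proof.
move=> d0 mf f0.
pose phi : {mfun Rn R n >-> Rn R n} := HB.pack
  (fun x => d *: (x : 'rV[R]_n) : Rn R n)
  (isMeasurableFun.Build _ _ _ _ _ (measurable_dilate d d0)).
have dn0 : 0 <= d ^+ n by rewrite exprn_ge0 ?ltW.
rewrite (eq_measure_integral (mscale (NngNum dn0) (pushforward (leb R n) phi))); last first.
  by move=> A mA _; rewrite /mscale/= /pushforward; exact: lebesgue_outer_dilation.
rewrite ge0_integral_mscale//; congr (_ * _)%E.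
rewrite ge0_integral_pushforward//; exact: measurable_dilate.
Qed.

Lemma measurable_dilation {R : realType} {n : nat} (d : R)
    (f : Rn R n -> \bar R) : 0 < d ->
  measurable_fun setT f -> measurable_fun setT (dilation d f).
Proof.
by move=> d0 mf; apply: (measurableT_comp mf (measurable_dilate d d0)).
Qed.

(** * The grid *)

Definition grid_cell {R : realType} {n : nat} (s : {posnum R}) (x : 'rV[R]_n) :
  'rV[int]_n := \row_i Num.floor (x ord0 i / s%:num).

(** The cube concentric with the cell [z] and three times as large. *)
Definition grid_cube {R : realType} {n : nat} (s : {posnum R}) (z : 'rV[int]_n) :
  cube R n := (\row_i (s%:num * (z ord0 i)%:~R - s%:num), (3 * s%:num)%:pos).

Definition dyadic {R : realType} (b : bool) (j : nat) : {posnum R} :=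
  if b then (2 ^+ j)%:pos else (2 ^- j)%:pos.

Lemma grid_cellP {R : realType} {n : nat} (s : {posnum R}) (x : 'rV[R]_n) z :
  grid_cell s x = z <-> forall i,
    x ord0 i \in `[s%:num * (z ord0 i)%:~R, s%:num * (z ord0 i)%:~R + s%:num[.
Proof.
have cellE i k : (Num.floor (x ord0 i / s%:num) == k) =
    (x ord0 i \in `[s%:num * k%:~R, s%:num * k%:~R + s%:num[).
  rewrite floor_eq in_itv/= ler_pdivlMr// ltr_pdivrMr// intrD mulrDl mul1r.
  by rewrite [_ * s%:num]mulrC.
split=> [<- i|xz]; first by rewrite -cellE mxE.
by apply/rowP => i; rewrite mxE; apply/eqP; rewrite cellE.
Qed.

Lemma measurable_grid_cell {R : realType} {n : nat} (s : {posnum R}) z :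
  measurable ([set x | grid_cell s x = z] : set (Rn R n)).
Proof.
have := @measurable_box R n
  (fun i => `[s%:num * (z ord0 i)%:~R, s%:num * (z ord0 i)%:~R + s%:num[).
by congr measurable; apply/seteqP; split=> x /grid_cellP.
Qed.

(** The cell contains a closed cube of half its side; the loss of a factor
    [2 ^ n] is harmless. *)
Lemma leb_grid_cell_ge {R : realType} {n : nat} (s : {posnum R}) (z : 'rV[int]_n) :
  (((s%:num / 2) ^+ n)%:E <= leb R n [set x | grid_cell s x = z])%E.
Proof.
have s0 : 0 < s%:num / 2 by [].
pose Q : cube R n := (\row_i (s%:num * (z ord0 i)%:~R), PosNum s0).
have <- : leb R n (cube_set Q) = ((s%:num / 2) ^+ n)%:E by rewrite leb_cube.
apply: le_measure; rewrite ?inE.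
- exact: measurable_cube.
- exact: measurable_grid_cell.
move=> x Qx; apply/grid_cellP => i; have := Qx i; rewrite mxE /side/= in_itv/=.
move=> /andP[-> /le_lt_trans]; apply; rewrite ltrD2l.
by rewrite ltr_pdivrMr// ltr_pMr// ltr1n.
Qed.

Lemma cube_sub_grid_cube {R : realType} {n : nat} (s : {posnum R}) (Q : cube R n) x :
  cube_set Q x -> side Q <= s%:num ->
  cube_set Q `<=` cube_set (grid_cube s (grid_cell s x)).
Proof.
move=> Qx Qs y Qy i; have := Qx i; have := Qy i.
have /grid_cellP/(_ i) : grid_cell s x = grid_cell s x by [].
rewrite in_itv/= /side mxE/=; move: Qs; rewrite /side.
move: (x _ _) (y _ _) (Q.1 _ _) (Q.2%:num) (_%:~R) (s%:num) => X Y c l k S.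
by move=> lS /andP[? ?] /andP[? ?] /andP[? ?]; apply/andP; split; lra.
Qed.

Lemma grid_cube_refl {R : realType} {n : nat} (s : {posnum R}) (x : 'rV[R]_n) :
  cube_set (grid_cube s (grid_cell s x)) x.
Proof.
have xx : cube_set (x, s) x by move=> i; rewrite /side/= lexx lerDl/=.
exact: (cube_sub_grid_cube s (x, s) x xx (lexx _) x xx).
Qed.

Lemma exists_dyadic {R : realType} (l : R) : 0 < l ->
  exists b j, l <= (dyadic b j)%:num <= 2 * l.
Proof.
move=> l0; have powlt (t : R) : exists j : nat, t < 2 ^+ j.
  have [j tj] : exists j : nat, t < j%:R.
    by exists (Num.bound `|t|); exact: le_lt_trans (ler_norm _) (archi_boundP (normr_ge0 _)).
  by exists j; apply: lt_trans tj _; rewrite -natrX ltr_nat ltn_expl.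
have [l1|l1] := leP l 1.
  have [[|j]] := ex_minnP (powlt l^-1) => lj minj.
    by move: lj; rewrite expr0 invf_lt1// ltNge l1.
  exists false, j; rewrite /dyadic/=.
  have : ~~ (l^-1 < 2 ^+ j) by apply/negP => /minj; rewrite ltnn.
  rewrite -leNgt => h1; apply/andP; split.
    by rewrite -[l]invrK lef_pV2 ?posrE ?invr_gt0.
  rewrite -[2 ^- j]mul1r ler_pdivrMr ?exprn_gt0//.
  by move: lj; rewrite -[l^-1]mul1r ltr_pdivrMr// exprS mulrAC => /ltW.
have [[|j]] := ex_minnP (powlt l) => lj minj; first by move: lj; rewrite expr0 ltNge ltW.
exists true, j.+1; rewrite /dyadic/= ltW//=.
have : ~~ (l < 2 ^+ j) by apply/negP => /minj; rewrite ltnn.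
by rewrite -leNgt exprS ler_pM2l.
Qed.

(** There are countably many cells, so [phi] may be any function. *)
Lemma measurable_grid_step {R : realType} {n : nat} (s : {posnum R})
    d (T : measurableType d) (phi : 'rV[int]_n -> T) :
  measurable_fun [set: Rn R n] (fun x => phi (grid_cell s x)).
Proof.
move=> _ Y mY; rewrite setTI.

rewrite (_ : _ @^-1` _ = \bigcup_z
    (if z \in phi @^-1` Y then [set x : Rn R n | grid_cell s x = z] else set0)).
  apply: countable_bigcupT_measurable => [|z]; first exact: countableP.
  by case: ifP => _; [exact: measurable_grid_cell|exact: measurable0].
apply/seteqP; split=> [x Yx|x [z _]] /=.
  by exists (grid_cell s x) => //; rewrite mem_set.
by case: ifPn => [/set_mem Yz ->|].
Qed.

Lemma le_integral_grid_cells {R : realType} {n : nat} (s : {posnum R})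
    (F H : Rn R n -> \bar R) :
  measurable_fun setT F -> measurable_fun setT H ->
  (forall x, 0 <= F x)%E -> (forall x, 0 <= H x)%E ->
  (forall z, \int[leb R n]_(x in [set x | grid_cell s x = z]) F x <=
             \int[leb R n]_(x in [set x | grid_cell s x = z]) H x)%E ->
  (\int[leb R n]_x F x <= \int[leb R n]_x H x)%E.
Proof.
move=> mF mH F0 H0 FH.
pose E (k : nat) : set (Rn R n) :=
  if pickle_inv k is Some z then [set x | grid_cell s x = z] else set0.
have mE k : measurable (E k).
  by rewrite /E; case: pickle_inv => [z|]; [exact: measurable_grid_cell|exact: measurable0].
have tE : trivIset setT E.
  apply/trivIsetP => i j _ _ ij; apply/seteqP; split=> // x [].
  rewrite /E; case Ei: (pickle_inv i) => [z|//] /= xz.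
  case Ej: (pickle_inv j) => [z'|//] /= xz'.
  move: ij; have := pickle_invK (T:='rV[int]_n) i; have := pickle_invK (T:='rV[int]_n) j.
  by rewrite Ei Ej /= -xz -xz' => <- <-; rewrite eqxx.
have ET : setT = \bigcup_k E k.
  apply/seteqP; split=> // x _; exists (pickle (grid_cell s x)) => //.
  by rewrite /E pickleK_inv.
rewrite ET !ge0_integral_bigcup//; [|exact: measurable_funS mH|exact: measurable_funS mF].
apply: lee_nneseries => [k _ _|k _]; first exact: integral_ge0.
by rewrite /E; case: pickle_inv => [z|]; rewrite ?integral_set0.
Qed.

(** * Auxiliary inequalities *)

(** The integral of a nonnegative function is a supremum over the simple
    functions below it, whether the function is measurable or not. *)
Lemma ge0_le_integral_nomeas {d} {T : measurableType d} {R : realType}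
    (mu : {measure set T -> \bar R}) (f g : T -> \bar R) :
  (forall x, 0 <= f x)%E -> (forall x, f x <= g x)%E ->
  (\int[mu]_x f x <= \int[mu]_x g x)%E.
Proof.
move=> f0 fg; rewrite !ge0_integralE// => [|x _]; last exact: le_trans (fg x).
apply: ereal_sup_le => _ [h hf <-]; exists h => // x.
by apply: le_trans (hf x) _; rewrite !patch_setT.
Qed.

(** A two-sided geometric series: the first [j] with [g ^ j <= d] separates the
    terms that grow from those that decay.  The bound does not depend on where
    this happens, that is, on [d]. *)
Lemma sum_min_geometric {R : realType} (g d : R) (N : nat) :
  0 < g < 1 -> 0 < d ->
  \sum_(j < N) Num.min (d / g ^+ j) (g ^+ j / d) <= 2 / (1 - g).
Proof.
move=> /andP[g0 g1] d0.
(* the potential decreases by at least the first term when d becomes d / g *)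
pose Phi (t : R) := if 1 <= t then (1 - g)^-1 / t else 2 / (1 - g) - t * (g / (1 - g)).
have g1' : 0 < 1 - g by lra.
have Phi_ge0 t : 0 < t -> 0 <= Phi t.
  move=> t0; rewrite /Phi; case: (leP 1 t) => t1; first by rewrite divr_ge0// ?invr_ge0 ltW.
  rewrite mulrA -mulrBl divr_ge0//; [nra|lra].
have Phi_le t : 0 < t -> Phi t <= 2 / (1 - g).
  move=> t0; rewrite /Phi; case: (leP 1 t) => t1.
    rewrite mulrC ler_pM2r ?invr_gt0// (@le_trans _ _ 1) ?invf_le1//; lra.
  by rewrite gerBl; apply: mulr_ge0; [exact: ltW|apply: divr_ge0; exact: ltW].
have Phi_step t : 0 < t -> Num.min t t^-1 + Phi (t / g) <= Phi t.
  move=> t0; have tg : t <= t / g by rewrite ler_pdivlMr// ler_piMr// ltW.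
  rewrite /Phi; have [t1|t1] := leP 1 t.
    rewrite (le_trans t1 tg) invf_div.
    have ti : Num.min t t^-1 <= t^-1 by rewrite ge_min lexx orbT.
    apply: (le_trans (lerD ti (lexx _))); rewrite le_eqVlt; apply/orP; left; apply/eqP.
    by field; rewrite !gt_eqF.
  have ti : Num.min t t^-1 <= t by rewrite ge_min lexx.
  apply: (le_trans (lerD ti (lexx _))).
  have [tg1|tg1] := leP 1 (t / g); last first.
    rewrite le_eqVlt; apply/orP; left; apply/eqP.
    by field; rewrite !gt_eqF.
  have gt : g <= t by move: tg1; rewrite ler_pdivlMr// mul1r.
  have e1 : (1 - g)^-1 / (t / g) <= (1 - g)^-1.
    apply: ler_piMr; first by rewrite invr_ge0 ltW.
    by rewrite invf_le1// divr_gt0.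
  have e2 : t * (g / (1 - g)) <= g / (1 - g).
    by apply: ler_piMl; [apply: divr_ge0|]; exact: ltW.
  have e3 : 2 / (1 - g) - g / (1 - g) = (1 - g)^-1 + 1.
    by field; rewrite gt_eqF.
  lra.
suff : \sum_(j < N) Num.min (d / g ^+ j) (g ^+ j / d) <= Phi d.
  by move=> /le_trans; apply; exact: Phi_le.
elim: N d d0 => [|N IHN] d d0; first by rewrite big_ord0 Phi_ge0.
rewrite big_ord_recl expr0 divr1 mul1r (le_trans _ (Phi_step d d0))// lerD2l.
apply: le_trans (IHN (d / g) _); last by rewrite divr_gt0.
apply: ler_sum => j _; rewrite lift0 exprS.
have gj : g ^+ j != 0 by rewrite gt_eqF ?exprn_gt0.
rewrite (_ : d / (g * g ^+ j) = d / g / g ^+ j); last by field; rewrite gj !gt_eqF.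
by rewrite (_ : g * g ^+ j / d = g ^+ j / (d / g))//; field; rewrite !gt_eqF.
Qed.

(** Concavity of the logarithm, in the form [ln t <= t - 1] at
    [t = a i / S] with [S] the weighted mean. *)
Lemma weighted_AM_GM {R : realType} (m : nat) (w a : 'I_m -> R) :
  (forall i, 0 < w i) -> \sum_i w i = 1 -> (forall i, 0 <= a i) ->
  \prod_i (a i `^ w i) <= \sum_i w i * a i.
Proof.
move=> w0 w1 a0.
have S0 : 0 <= \sum_i w i * a i by apply: sumr_ge0 => i _; rewrite mulr_ge0// ltW.
have [/existsP[i /eqP ai0]|/existsPn an0] := boolP [exists i, a i == 0].
  by rewrite (bigD1 i)//= ai0 powR0 ?gt_eqF// mul0r.
have {}a0 i : 0 < a i by rewrite lt0r an0 a0.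
have m0 : (0 < m)%N.
  by case: m w a w0 w1 a0 {S0 an0} => // w a _; rewrite big_ord0 => /eqP; rewrite eq_sym oner_eq0.
have {}S0 : 0 < \sum_i w i * a i.
  rewrite (bigD1 (Ordinal m0))//= ltr_pwDl ?mulr_gt0//.
  by apply: sumr_ge0 => i _; rewrite mulr_ge0// ltW.
set S := \sum_i _ in S0 *.
rewrite -[leRHS](lnK S0).
have -> : \prod_i (a i `^ w i) = expR (\sum_i w i * ln (a i)).
  by rewrite expR_sum; apply: eq_bigr => i _; rewrite /powR gt_eqF.
rewrite ler_expR -subr_le0 -[ln S]mul1r -w1 mulr_suml -sumrB.
apply: (@le_trans _ _ (\sum_i w i * (a i / S - 1))).
  apply: ler_sum => i _; rewrite -mulrBr ler_pM2l// -ln_div ?posrE//.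
  have aS : 0 < a i / S by rewrite divr_gt0.
  by have := @le_ln1Dx R (a i / S - 1); rewrite addrCA subrr addr0; apply; rewrite ltrBrDl subrr.
under eq_bigr do rewrite mulrBr mulr1 mulrA.
by rewrite sumrB -mulr_suml w1 -/S divff ?gt_eqF// subrr.
Qed.

Lemma powR_prod {R : realType} (m : nat) (r : R) (a : 'I_m -> R) :
  (forall i, 0 <= a i) -> \prod_i (a i `^ r) = (\prod_i a i) `^ r.
Proof.
move=> a0; suff [] : 0 <= \prod_i a i /\ \prod_i (a i `^ r) = (\prod_i a i) `^ r by [].
apply: (big_ind2 (fun x y : R => 0 <= x /\ y = x `^ r)) => [|x1 x2 y1 y2|i _].
- by rewrite powR1 ler01.
- by move=> [x0 ->] [y0 ->]; rewrite mulr_ge0// powRM.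
- by rewrite a0.
Qed.

Lemma le_poweR {R : realType} (r : R) (x y : \bar R) : 0 <= r ->
  (0 <= x)%E -> (x <= y)%E -> (x `^ r <= y `^ r)%E.
Proof.
move=> r0 x0 xy; apply: gt0_ler_poweR => //; rewrite in_itv/= leey andbT//.
exact: le_trans xy.
Qed.

Lemma nneseries_le_bound {R : realType} (u : nat -> \bar R) (M : \bar R) :
  (forall j, 0 <= u j)%E -> (forall N, \sum_(j < N) u j <= M)%E ->
  (\sum_(0 <= j <oo) u j <= M)%E.
Proof.
move=> u0 uM; apply: lime_le; first exact: is_cvg_nneseries.
by apply: nearW => N; rewrite big_mkord.
Qed.

(** In the application [v] is a lower bound for the volume of a cell.  The two
    bounds for [c] balance at [v * h = 1]; away from that volume the estimate
    improves like a power of the ratio. *)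
Lemma hedberg_term {R : realType} (s v h c : R) :
  1 < s -> 0 < v -> 0 < h -> 0 <= c -> c <= h -> c <= v^-1 ->
  v `^ (s - 1) * c `^ s <= h * Num.min (v * h) (v * h)^-1 `^ Num.min (s - 1) 1.
Proof.
move=> s1 v0 h0 c0 ch cv; set th := Num.min (s - 1) 1.
have vh0 : 0 < v * h by rewrite mulr_gt0.
have [vW hW vhW] : [/\ 0 <= v, 0 <= h & 0 <= v * h] by rewrite !ltW.
have s0 : 0 <= s by lra.
have th_s : th <= s - 1 by rewrite ge_min lexx.
have th_1 : th <= 1 by rewrite ge_min lexx orbT.
have [vh1|vh1] := leP (v * h) 1.
  rewrite (min_idPl _); last first.
    by rewrite (le_trans vh1)// invf_ge1.
  apply: (@le_trans _ _ (v `^ (s - 1) * h `^ s)).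
    by rewrite ler_wpM2l ?powR_ge0// ge0_ler_powR ?nnegrE.
  have -> : h `^ s = h * h `^ (s - 1).
    have := @powRD R h 1 (s - 1); rewrite addrC subrK powRr1//; apply.
    by rewrite (gt_eqF h0) implybT.
  rewrite mulrCA -powRM// ler_pM2l//.
  by rewrite ger_powR ?vh0.
rewrite (min_idPr _); last first.
  by rewrite (@le_trans _ _ 1)// ?invf_le1// ltW.
apply: (@le_trans _ _ (v `^ (s - 1) * v^-1 `^ s)).
  by rewrite ler_wpM2l ?powR_ge0// ge0_ler_powR ?nnegrE ?invr_ge0.
have -> : v `^ (s - 1) * v^-1 `^ s = h * (v * h)^-1.
  rewrite -powR_inv1// -powRrM mulN1r -powRD; last by rewrite (gt_eqF v0) implybT.
  rewrite addrAC subrr add0r powR_inv1//.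
  by field; rewrite !gt_eqF.
rewrite ler_pM2l//.
rewrite -[leLHS]powRr1 ?invr_ge0//.
by rewrite ger_powR// ?invr_gt0 ?vh0// invf_le1// ltW.
Qed.

(** The sum over the scales [2 ^ j], or [2 ^- j], is dominated by its largest
    term, because the bound of [hedberg_term] is geometric on each side of the
    critical scale.  Neither the critical scale nor the number of terms enters
    the constant. *)
Lemma hedberg_sum {R : realType} (n : nat) (s : R) : (0 < n)%N -> 1 < s ->
  exists2 C : R, 0 < C & forall (b : bool) (N : nat) (h : R) (c : nat -> R),
    (forall j, 0 <= c j <= h) ->
    (forall j, c j <= (((dyadic b j)%:num / 2) ^+ n)^-1) ->
    \sum_(j < N) (((dyadic b j)%:num / 2) ^+ n) `^ (s - 1) * c j `^ s <= C * h.
Proof.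
move=> n0 s1; pose th : R := Num.min (s - 1) 1.
have th0 : 0 < th by rewrite lt_min ltr01 andbT; lra.
pose e : R := 2 ^- n; have e0 : 0 < e by rewrite invr_gt0 exprn_gt0.
pose g := e `^ th; have g0 : 0 < g by rewrite powR_gt0.
have g1 : g < 1.
  have p1 : 1 `^ th = 1 :> R by rewrite powR1.
  rewrite /g -[X in _ < X]p1 gt0_ltr_powR ?nnegrE ?ltW// invf_lt1 ?exprn_gt0//.
  by rewrite exprn_egt1 ?ltr1n// -lt0n.
exists (2 / (1 - g)); first by rewrite divr_gt0// subr_gt0.
move=> b N h c ch cv.
have h0 : 0 <= h by have /andP[] := ch 0; apply: le_trans.
have [h0'|hn0] := eqVneq h 0.
  rewrite h0' mulr0 big1// => j _; have := ch j; rewrite h0' => /le_anti <-.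
  by rewrite powR0 ?mulr0// gt_eqF//; lra.
have {hn0}h0 : 0 < h by rewrite lt0r hn0.
pose v j : R := ((dyadic b j)%:num / 2) ^+ n.
have v0 j : 0 < v j by rewrite exprn_gt0.
apply: (@le_trans _ _
    (\sum_(j < N) h * Num.min (v j * h) (v j * h)^-1 `^ th)).
  apply: ler_sum => j _; have /andP[c0 cj] := ch j.
  by apply: hedberg_term => //; exact: cv.
rewrite -mulr_sumr mulrC ler_pM2r//.
have powR_min (x : R) : 0 < x -> Num.min x x^-1 `^ th = Num.min (x `^ th) (x `^ th)^-1.
  move=> x0; have xV : x^-1 `^ th = (x `^ th)^-1.
    by rewrite -powR_inv1 ?ltW// -powRrM mulN1r powRN.
  have [x1|x1] := leP x x^-1; rewrite -xV.
    by rewrite (min_idPl _)// ge0_ler_powR ?nnegrE ?invr_ge0 ?(ltW x0) ?(ltW th0).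
  by rewrite (min_idPr _)// ge0_ler_powR ?nnegrE ?invr_ge0 ?(ltW x0) ?(ltW th0) ?(ltW x1).
under eq_bigr do rewrite powR_min ?mulr_gt0//.
have eX j : (e ^+ j) `^ th = g ^+ j.
  rewrite -(powR_mulrn j (ltW e0)) -powRrM mulrC powRrM -/g.
  by rewrite powR_mulrn// ltW.
pose d := (e * h) `^ th.
have d0 : 0 < d by rewrite powR_gt0 ?mulr_gt0.
have gj0 j : 0 < g ^+ j by rewrite exprn_gt0.
have twoX j : (2 ^+ j) ^+ n = (e ^+ j)^-1 :> R by rewrite /e exprVn invrK exprAC.
have eE : 2^-1 ^+ n = e by rewrite exprVn.
have vE j : (v j * h) `^ th = if b then d / g ^+ j else d * g ^+ j.
  rewrite /v /dyadic; case: (b) => /=.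
    rewrite (_ : _ * h = (e * h) * (e ^+ j)^-1); last first.
      by rewrite exprMn twoX eE; ring.
    rewrite powRM ?invr_ge0 ?exprn_ge0 ?mulr_ge0 ?(ltW e0) ?(ltW h0)//; congr (_ * _).
    by rewrite -powR_inv1 ?exprn_ge0 ?(ltW e0)// -powRrM mulN1r powRN eX.
  rewrite (_ : _ * h = (e * h) * e ^+ j); last first.
    by rewrite exprMn eE exprVn twoX invrK; ring.
  by rewrite powRM ?exprn_ge0 ?mulr_ge0 ?(ltW e0) ?(ltW h0)// eX.
under eq_bigr do rewrite vE.
have g01 : 0 < g < 1 by rewrite g0.
case: (b) => /=.
  under eq_bigr do rewrite invf_div.
  exact: sum_min_geometric.
have := @sum_min_geometric R g d^-1 N g01; rewrite invr_gt0 => /(_ d0).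
congr (_ <= _); apply: eq_bigr => j _; rewrite minC invrK mulrC; congr Num.min.
by rewrite invfM.
Qed.

(** * Averages in function norms *)

Lemma measurable_cube_restriction {R : realType} {n : nat} (Q : cube R n)
    (f : Rn R n -> \bar R) : measurable_fun setT f ->
  measurable_fun setT (fun x : Rn R n => f x * (\1_(cube_set Q) x)%:E)%E.
Proof.
move=> mf; apply: emeasurable_funM; first exact: mf.
by apply/measurable_EFinP; apply: measurable_indic; exact: measurable_cube.
Qed.

Lemma measurable_fun_abs {d} {T : measurableType d} {R : realType}
    (f : T -> \bar R) : measurable_fun setT f ->
  measurable_fun setT (fun x => `|f x|%E).
Proof. by move=> mf; apply: (measurableT_comp _ mf); exact: abse_measurable. Qed.

Lemma Mplus_abs {R : realType} {n : nat} (f : Rn R n -> \bar R) :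
  measurable_fun setT f -> Mplus (fun x => `|f x|%E).
Proof. by move=> mf; split=> [|x]; [exact: measurable_fun_abs|exact: abse_ge0]. Qed.

(** The dilated function vanishes nowhere on a cube of positive measure, so it is
    not zero almost everywhere. *)
Lemma bfs_norm_average_gt0 {R : realType} {n : nat}
    (X : banach_function_space R n) (Q : cube R n) (h : Rn R n -> \bar R) :
  measurable_fun setT h -> (forall x, cube_set Q x -> h x != 0%E) ->
  (0 < norm_average (bfs_norm X) Q h)%E.
Proof.
move=> mh hQ; have axX := bfs_axioms X; have s0 : 0 < side Q by rewrite /side.
have mhQ := measurable_dilation (side Q) _ s0 (measurable_cube_restriction Q h mh).
have Mk := Mplus_abs _ mhQ.
rewrite /norm_average /bfs_norm; move: Mk; set k := dilation _ _ => Mk.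
rewrite lt0e (bfn_ge0 axX)// andbT; apply/eqP => /(bfn_eq0 axX Mk) [N [mN N0 kN]].
(* the dilated cube is not negligible *)
have : (leb R n [set x | cube_set Q (side Q *: x)] <= leb R n N)%E.
  apply: le_measure; rewrite ?inE//.
    have := measurable_dilate (side Q) s0 measurableT _ (measurable_cube Q).
    by rewrite setTI.
  move=> x Qx; apply: kN => /=; rewrite /k /dilation indicE mem_set// mule1.
  by move/eqP; rewrite abse_eq0; apply/negP; exact: hQ.
rewrite N0 leNgt => /negP; apply.
have := lebesgue_outer_dilation (side Q) (cube_set Q) s0.
rewrite [LHS](leb_cube Q) => E.
rewrite lt0e measure_ge0 andbT; apply/eqP => L0.
move: E; rewrite [X in (_ * X)%E]L0 mule0 => /eqP.
by rewrite eqe expf_eq0 gt_eqF// andbF.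
Qed.
(** After dilating [Q] to side 1, divide [h] by its norm and use it as a test
    function in the definition of the norm of [X']. *)
Lemma associate_hoelder_average {R : realType} {n : nat}
    (X : banach_function_space R n) (Q : cube R n) (g h : Rn R n -> \bar R) :
  measurable_fun setT g -> measurable_fun setT h ->
  (0 < norm_average (bfs_norm X) Q h < +oo)%E ->
  (\int[leb R n]_(x in cube_set Q) `|g x * h x| <=
   (side Q ^+ n)%:E * (norm_average (associate_norm X) Q g *
                       norm_average (bfs_norm X) Q h))%E.
Proof.
move=> mg mh /andP[B0 Boo]; have axX := bfs_axioms X.
have s0 : 0 < side Q by rewrite /side.
pose gQ (x : Rn R n) := (g x * (\1_(cube_set Q) x)%:E)%E.
pose hQ (x : Rn R n) := (h x * (\1_(cube_set Q) x)%:E)%E.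
have mgQ : measurable_fun setT gQ := measurable_cube_restriction Q g mg.
have mhQ : measurable_fun setT hQ := measurable_cube_restriction Q h mh.
have mghQ := measurable_fun_abs _ (emeasurable_funM mgQ mhQ).
have -> : (\int[leb R n]_(x in cube_set Q) `|g x * h x| =
    \int[leb R n]_x `|gQ x * hQ x|)%E.
  rewrite integral_mkcond; apply: eq_integral => x _.
  rewrite patchE /gQ /hQ indicE; case: ifPn => xQ.
    by rewrite ?xQ !mule1.
  by rewrite ?(negbTE xQ) !mule0 abse0.
rewrite (ge0_integral_dilation (side Q) _ s0 mghQ (fun x => abse_ge0 _)).
rewrite lee_pmul2l ?lte_fin ?exprn_gt0//.
set B := norm_average (bfs_norm X) Q h in B0 Boo *.
have [r r0 BE] : exists2 r : R, 0 < r & B = r%:E.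
  move: B0 Boo; case: B => [r|//|//]; rewrite lte_fin => r0 _.
  by exists r.
pose k : Rn R n -> \bar R := fun x => (r^-1%:E * dilation (side Q) hQ x)%E.
have mdh := measurable_dilation _ _ s0 mhQ.
have mk : measurable_fun setT k := measurable_funeM r^-1%:E mdh.
have Xk : (bfs_norm X k <= 1)%E.
  rewrite /bfs_norm; have -> : (fun x => `|k x|%E) =
      (fun x => r^-1%:E * `|dilation (side Q) hQ x|)%E.
    by apply/funext => x; rewrite abseM gee0_abs// lee_fin invr_ge0 ltW.
  rewrite (bfnZ axX); [|by rewrite invr_ge0 ltW|exact: Mplus_abs].
  rewrite -[X (fun x => `|_|%E)]/B BE.
  by rewrite -EFinM mulVf// gt_eqF.
have mdg := measurable_dilation _ _ s0 mgQ.
have : (\int[leb R n]_x `|dilation (side Q) gQ x * k x| <=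
    norm_average (associate_norm X) Q g)%E by apply: ereal_sup_ubound; exists k.
rewrite BE -lee_pdivrMr//.
congr (_ <= _)%E; rewrite muleC -ge0_integralZl.
- apply: eq_integral => x _; rewrite /k muleCA abseM gee0_abs// lee_fin invr_ge0.
  exact: ltW.
- exact: measurableT.
- exact: measurable_fun_abs (emeasurable_funM mdg mdh).
- by move=> x _; exact: abse_ge0.
- by rewrite lee_fin invr_ge0 ltW.
Qed.

Lemma associate_norm_averageZ {R : realType} {n : nat}
    (X : banach_function_space R n) (Q : cube R n) (a : R) (f : Rn R n -> \bar R) :
  0 < a -> measurable_fun setT f ->
  norm_average (associate_norm X) Q (fun x => a%:E * f x)%E =
  (a%:E * norm_average (associate_norm X) Q f)%E.
Proof.
move=> a0 mf; rewrite /norm_average /associate_norm -ereal_sup_pZl//.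
have s0 : 0 < side Q by rewrite /side.
have mfQ := measurable_dilation _ _ s0 (measurable_cube_restriction Q f mf).
have E (g : Rn R n -> \bar R) : measurable_fun setT g ->
  (\int[leb R n]_x `|dilation (side Q)
     (fun x0 => a%:E * f x0 * (\1_(cube_set Q) x0)%:E) x * g x| =
  a%:E * \int[leb R n]_x `|dilation (side Q)
     (fun x0 => f x0 * (\1_(cube_set Q) x0)%:E) x * g x|)%E.
  move=> mg; rewrite -ge0_integralZl.
  - apply: eq_integral => x _; rewrite /dilation -!muleA abseM gee0_abs//.
    by rewrite lee_fin ltW.
  - exact: measurableT.
  - exact: measurable_fun_abs (emeasurable_funM mfQ mg).
  - by move=> x _; exact: abse_ge0.
  - by rewrite lee_fin ltW.
congr ereal_sup; apply/seteqP; split=> [_ [g [mg Xg] <-]|_ [_ [g [mg Xg] <-] <-]].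
- rewrite E//.
  by exists (\int[leb R n]_x `|dilation (side Q)
     (fun x0 => f x0 * (\1_(cube_set Q) x0)%:E) x * g x|)%E => //; exists g.
- by exists g; rewrite ?E.
Qed.

(** * Summation over the scales of the grid *)

(** A lower bound on a cell, integrated over a closed subcube of half the side. *)
Lemma ge0_integral_cell_ge {R : realType} {n : nat} (s : {posnum R}) z
    (a : R) (F : Rn R n -> \bar R) :
  measurable_fun setT F -> (forall x, 0 <= F x)%E -> 0 <= a ->
  (forall x, grid_cell s x = z -> (a%:E <= F x)%E) ->
  ((a * (s%:num / 2) ^+ n)%:E <=
    \int[leb R n]_(x in [set x | grid_cell s x = z]) F x)%E.
Proof.
move=> mF F0 a0 aF.
apply: (@le_trans _ _ (\int[leb R n]_(x in [set x | grid_cell s x = z]) a%:E)%E).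
  rewrite integral_cst; last exact: measurable_grid_cell.
  by rewrite EFinM lee_pmul// leb_grid_cell_ge.
apply: ge0_le_integral.
- exact: measurable_grid_cell.
- by move=> x _; rewrite lee_fin.
- exact: measurable_cst.
- exact: measurable_funTS.
- by move=> x /= xz; exact: aF.
Qed.

Lemma integral_cell_le {R : realType} {n : nat} (s : {posnum R}) z
    (F : Rn R n -> \bar R) :
  measurable_fun setT F -> (forall x, 0 <= F x)%E ->
  (\int[leb R n]_(x in [set x | grid_cell s x = z]) F x <= \int[leb R n]_x F x)%E.
Proof.
move=> mF F0; apply: ge0_subset_integral => //; exact: measurable_grid_cell.
Qed.

(** The coefficients [L t z] with weights [u(cell)] are controlled by the power
    [s > 1] of the volume times [c], where the [c] have a common majorant [H] of
    integral at most [1].  On a cell the measure [u dx] may be replaced by a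
    constant density, so that the sum over the scales can be done pointwise, by
    [hedberg_sum]; the second bound for [c] there comes from the average of [H]
    over the cell. *)
Lemma grid_packing {R : realType} (n : nat) (s : R) : (0 < n)%N -> 1 < s ->
  exists2 C : R, 0 < C &
    forall (b : bool) (c : {posnum R} -> 'rV[int]_n -> R)
      (L : {posnum R} -> 'rV[int]_n -> \bar R) (u H : Rn R n -> \bar R),
    measurable_fun setT u -> (forall x, 0 <= u x)%E ->
    measurable_fun setT H -> (forall x, 0 <= H x)%E ->
    (\int[leb R n]_x H x <= 1)%E ->
    (forall t z, 0 <= c t z) -> (forall t z, 0 <= L t z)%E ->
    (forall j x, ((c (dyadic b j) (grid_cell (dyadic b j) x))%:E <= H x)%E) ->
    (forall j z, L (dyadic b j) z *
         \int[leb R n]_(x in [set x | grid_cell (dyadic b j) x = z]) u x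
       <= ((((dyadic b j)%:num / 2) ^+ n) `^ s * c (dyadic b j) z `^ s)%:E)%E ->
    (\int[leb R n]_x (\sum_(0 <= j <oo)
        L (dyadic b j) (grid_cell (dyadic b j) x) * u x) <= C%:E)%E.
Proof.
move=> n0 s1; have [C C0 hedberg] := hedberg_sum n s n0 s1.
exists C => // b c L u H mu u0 mH H0 H1 c0 L0 cH Lc.
have mL t : measurable_fun setT
    (fun x : Rn R n => L t (grid_cell t x) * u x)%E.
  by apply: emeasurable_funM; [exact: measurable_grid_step|exact: mu].
have Lu0 t (x : Rn R n) : (0 <= L t (grid_cell t x) * u x)%E.
  by apply: mule_ge0.
rewrite integral_nneseries//.
pose K t (x : Rn R n) : \bar R :=
  (((t%:num / 2) ^+ n) `^ (s - 1) * c t (grid_cell t x) `^ s)%:E.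
have mK t : measurable_fun setT (K t).
  exact: (measurable_grid_step t _ _
    (fun z => (((t%:num / 2) ^+ n) `^ (s - 1) * c t z `^ s)%:E)).
have K0 t x : (0 <= K t x)%E by rewrite lee_fin mulr_ge0 ?powR_ge0.
have LK j : (\int[leb R n]_x (L (dyadic b j) (grid_cell (dyadic b j) x) * u x) <=
    \int[leb R n]_x K (dyadic b j) x)%E.
  set t := dyadic b j.
  apply: (le_integral_grid_cells t) => // z.
  rewrite (eq_integral (fun x => L t z * u x)%E); last first.
    by move=> x /set_mem /= ->.
  have t0 : 0 < (t%:num / 2) ^+ n by rewrite exprn_gt0.
  rewrite ge0_integralZl//; [|exact: measurable_grid_cell|exact: measurable_funTS].
  apply: (le_trans (Lc j z)).
  apply: le_trans (ge0_integral_cell_ge t z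
    (((t%:num / 2) ^+ n) `^ (s - 1) * c t z `^ s) (K t) (mK t) (K0 t) _ _).
  - rewrite lee_fin mulrAC -[X in _ <= _ * X * _]powRr1 ?(ltW t0)//.
    by rewrite -powRD ?subrK//; rewrite (gt_eqF t0) implybT.
  - by rewrite mulr_ge0 ?powR_ge0.
  - by move=> x <-.
apply: (@le_trans _ _ (\sum_(0 <= j <oo) \int[leb R n]_x K (dyadic b j) x)%E).
  apply: lee_nneseries => [j _ _|j _]; last exact: LK.
  by apply: integral_ge0 => x _; exact: Lu0.
rewrite -integral_nneseries//.
apply: (@le_trans _ _ (\int[leb R n]_x (C%:E * H x))%E); last first.
  rewrite ge0_integralZl//; last by rewrite lee_fin ltW.
  by rewrite -[leRHS]mule1 lee_pmul2l.
(* the average of H over a cell bounds c *)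
have cv j z : c (dyadic b j) z <= (((dyadic b j)%:num / 2) ^+ n)^-1.
  set t := dyadic b j; have t0 : 0 < (t%:num / 2) ^+ n by rewrite exprn_gt0.
  rewrite -[leRHS]mul1r ler_pdivlMr// -lee_fin.
  apply: le_trans H1; apply: le_trans (integral_cell_le t z H mH H0).
  by apply: ge0_integral_cell_ge => // x <-; exact: cH.
apply: ge0_le_integral_nomeas => [x|x]; first exact: nneseries_ge0.
apply: nneseries_le_bound => // N.
have := H0 x; have cHx j := cH j x.
case Hx: (H x) => [h| |]//; last first.
  by move=> _; rewrite gt0_muley ?lte_fin// leey.
rewrite lee_fin => h0; rewrite -EFinM sumEFin lee_fin.
apply: (hedberg b N h (fun j => c (dyadic b j) (grid_cell (dyadic b j) x))).
- by move=> j; rewrite c0/= -lee_fin -Hx.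
- by move=> j; exact: cv.
Qed.

(** * The maximal operator of the associate space *)

(** All powers of two in a single sequence. *)
Definition scale {R : realType} (k : nat) : {posnum R} := dyadic (odd k) k./2.

Lemma scale_dyadic {R : realType} (b : bool) (j : nat) :
  dyadic b j = scale (b + j.*2) :> {posnum R}.
Proof. by rewrite /scale oddD odd_double addbF half_bit_double; case: b. Qed.

Definition grid_average {R : realType} {n : nat} (X : banach_function_space R n)
    (g : Rn R n -> \bar R) (t : {posnum R}) (z : 'rV[int]_n) : \bar R :=
  norm_average (associate_norm X) (grid_cube t z) g.

(** Restricting the supremum to countably many cubes, each depending on [x] only
    through its cell, makes the maximal function measurable. *)
Definition grid_maximal {R : realType} {n : nat} (X : banach_function_space R n)
    (g : Rn R n -> \bar R) (x : Rn R n) : \bar R :=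
  ereal_sup [set grid_average X g (scale k) (grid_cell (scale k) x) | k in setT].

Lemma associate_norm_ge0 {R : realType} {n : nat} (X : banach_function_space R n)
    (f : Rn R n -> \bar R) : (0 <= associate_norm X f)%E.
Proof.
apply: ereal_sup_ubound; exists (cst 0%E).
  split; first exact: measurable_cst.
  have M0 : Mplus (fun x : Rn R n => `|cst 0 x|%E).
    by apply: Mplus_abs; exact: measurable_cst.
  rewrite /bfs_norm ((bfn_eq0 (bfs_axioms X) M0).2 _) ?lee01//.
  by apply/aeW => x; rewrite abse0.
by rewrite integral0_eq// => x _; rewrite mule0 abse0.
Qed.

Lemma grid_average_ge0 {R : realType} {n : nat} (X : banach_function_space R n)
    g t z : (0 <= grid_average (R := R) (n := n) X g t z)%E.
Proof. exact: associate_norm_ge0. Qed.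

Lemma grid_maximal_ge {R : realType} {n : nat} (X : banach_function_space R n)
    g b j (x : Rn R n) :
  (grid_average X g (dyadic b j) (grid_cell (dyadic b j) x) <= grid_maximal X g x)%E.
Proof. by apply: ereal_sup_ubound; rewrite scale_dyadic; exists (b + j.*2)%N. Qed.

Lemma grid_maximal_ge0 {R : realType} {n : nat} (X : banach_function_space R n)
    g (x : Rn R n) : (0 <= grid_maximal X g x)%E.
Proof. exact: le_trans (grid_average_ge0 _ _ _ _) (grid_maximal_ge X g true 0 x). Qed.

Lemma measurable_grid_maximal {R : realType} {n : nat}
    (X : banach_function_space R n) g : measurable_fun setT (grid_maximal X g).
Proof.
pose c k (x : Rn R n) := grid_average X g (scale k) (grid_cell (scale k) x).
have mc k : measurable_fun setT (c k).
  exact: (measurable_grid_step (scale k) _ _ (grid_average X g (scale k))).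
rewrite (_ : grid_maximal X g = fun x => esups (c ^~ x) 0%N).
  exact: measurable_fun_esups.
apply/funext => x; rewrite /esups/= /sdrop; congr ereal_sup.
by apply/seteqP; split=> y [k _ <-]; exists k.
Qed.

Lemma grid_maximalZ_le {R : realType} {n : nat} (X : banach_function_space R n)
    (a : R) g (x : Rn R n) : 0 < a -> measurable_fun setT g ->
  (a%:E * grid_maximal X g x <=
    norm_maximal (associate_norm X) (fun y => a%:E * g y) x)%E.
Proof.
move=> a0 mg; rewrite -ereal_sup_pZl//; apply: ge_ereal_sup => _ [_ [k _ <-] <-].
rewrite -associate_norm_averageZ//; apply: ereal_sup_ubound.
by exists (grid_cube (scale k) (grid_cell (scale k) x)) => //; exact: grid_cube_refl.
Qed.

(** The operator norm only bounds the image of the unit ball, so [g] is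
    normalised first; this needs a norm that is neither [0] nor infinite. *)
Lemma grid_maximal_Lp {R : realType} {n : nat} (X : banach_function_space R n)
    (p : R) g : 0 < p -> measurable_fun setT g ->
  (0 < 'N[leb R n]_p%:E[g] < +oo)%E ->
  (\int[leb R n]_x (grid_maximal X g x) `^ p <=
   (Lp_opnorm p (norm_maximal (associate_norm X)) * 'N[leb R n]_p%:E[g]) `^ p)%E.
Proof.
move=> p0 mg /andP[N0 Noo]; have pn0 : p != 0 by rewrite gt_eqF.
set M := norm_maximal (associate_norm X).
have [r r0 NE] : exists2 r : R, 0 < r & ('N[leb R n]_p%:E[g] = r%:E)%E.
  by move: N0 Noo; case: ('N[_]_ _[_])%E => [r|//|//] + _; rewrite lte_fin; exists r.
pose h x := (r^-1%:E * g x)%E.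
have ri0 : 0 < r^-1 by rewrite invr_gt0.
have mh : measurable_fun setT h := measurable_funeM r^-1%:E mg.
have mgp : measurable_fun setT (fun x => `|g x| `^ p)%E.
  exact: measurableT_comp (measurable_poweR p) (measurable_fun_abs _ mg).
have Nh : ('N[leb R n]_p%:E[h] <= 1)%E.
  have e1 : ('N[leb R n]_p%:E[h] `^ p = 1)%E.
    rewrite poweR_Lnorm// (eq_integral (fun x => (r^-1 `^ p)%:E * `|g x| `^ p)%E).
      rewrite ge0_integralZl//; last 2 first.
      - by move=> x _; exact: poweR_ge0.
      - by rewrite lee_fin powR_ge0.
      rewrite -poweR_Lnorm// NE -EFinM -powRM ?(ltW r0) ?(ltW ri0)//.
      by rewrite mulVf ?gt_eqF// powR1.
    move=> x _; rewrite /h abseM poweRM// gee0_abs ?lee_fin ?(ltW ri0)//.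
  have := congr1 (fun y => y `^ p^-1)%E e1.
  rewrite -poweRrM divff// poweRe1 ?Lnorm_ge0// => ->.
  by rewrite /poweR powR1.
have le_op : ('N[leb R n]_p%:E[M h] <= Lp_opnorm p M)%E.
  by apply: ereal_sup_ubound; exists h.
have G0 x := grid_maximal_ge0 X g x.
have mG := measurable_grid_maximal X g.
rewrite NE poweRM//; [|exact: le_trans (Lnorm_ge0 _ _ _) le_op|by rewrite lee_fin ltW].
apply: (@le_trans _ _ ((r `^ p)%:E *
    \int[leb R n]_x (r^-1%:E * grid_maximal X g x) `^ p)%E).
  rewrite -ge0_integralZl; last 4 first.
  - exact: measurableT.
  - exact: measurableT_comp (measurable_poweR p) (measurable_funeM _ mG).
  - by move=> x _; exact: poweR_ge0.
  - by rewrite lee_fin powR_ge0.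
  apply: ge0_le_integral_nomeas => [x|x]; first exact: poweR_ge0.
  rewrite poweRM// ?lee_fin ?(ltW ri0)// muleA -EFinM -powRM ?(ltW r0) ?(ltW ri0)//.
  by rewrite divff ?gt_eqF// powR1 mul1e.
rewrite muleC lee_pmul2r ?lte_fin ?powR_gt0//.
apply: (@le_trans _ _ ('N[leb R n]_p%:E[M h] `^ p)%E); last first.
  by apply: le_poweR => //; [exact: ltW|exact: Lnorm_ge0].
rewrite poweR_Lnorm//; apply: ge0_le_integral_nomeas => [x|x]; first exact: poweR_ge0.
have Mx := grid_maximalZ_le X r^-1 g x ri0 mg.
apply: le_poweR; first exact: ltW.
  by rewrite mule_ge0// lee_fin ltW.
exact: le_trans Mx (lee_abs _).
Qed.

(** Otherwise the averages of an indicator function in the norm of [X'] vanish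
    and, by duality with the same indicator function in [X], so does the volume of
    a cube. *)
Lemma Lp_opnorm_gt0 {R : realType} {n : nat} (X : banach_function_space R n)
    (p : R) : 0 < p -> (0 < Lp_opnorm p (norm_maximal (associate_norm X)))%E.
Proof.
move=> p0; set op := Lp_opnorm _ _; have pn0 : p != 0 by rewrite gt_eqF.
have op0 : (0 <= op)%E.
  apply: le_trans (Lnorm_ge0 (leb R n) p%:E (norm_maximal (associate_norm X) (cst 0%E))) _.
  apply: ereal_sup_ubound; exists (cst 0%E) => //; split; first exact: measurable_cst.
  by rewrite Lnorm0 ?lee01// eqe.
pose t : {posnum R} := dyadic true 0; pose z : 'rV[int]_n := 0.
pose Q := grid_cube t z; have s0 : 0 < side Q by rewrite /side.
have sn0 : 0 < side Q ^+ n by rewrite exprn_gt0.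
pose g (x : Rn R n) : \bar R := (\1_(cube_set Q) x)%:E.
have mg : measurable_fun setT g.
  by apply/measurable_EFinP; apply: measurable_indic; exact: measurable_cube.
have intg : (\int[leb R n]_x `|g x| `^ p = (side Q ^+ n)%:E)%E.
  rewrite -leb_cube -[RHS]mul1e -integral_cst; last exact: measurable_cube.
  rewrite [RHS]integral_mkcond; apply: eq_integral => x _.
  rewrite patchE /g indicE; case: ifPn => xQ; rewrite ?xQ ?(negbTE xQ)/=.
    by rewrite normr1 powR1.
  by rewrite normr0 powR0.
have Ng : ('N[leb R n]_p%:E[g] = ((side Q ^+ n) `^ p^-1)%:E)%E.
  have := poweR_Lnorm (leb R n) g pn0; rewrite intg => /(congr1 (fun y => y `^ p^-1)%E).
  by rewrite -poweRrM divff// poweRe1 ?Lnorm_ge0.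
have Ng0 : (0 < 'N[leb R n]_p%:E[g] < +oo)%E by rewrite Ng lte_fin powR_gt0// ltry.
rewrite lt0e op0 andbT; apply/eqP => opE.
have := grid_maximal_Lp X p g p0 mg Ng0; rewrite -/op opE mul0e poweR0r// => G0.
have c0 : grid_average X g t z = 0%E.
  apply/eqP; rewrite eq_le grid_average_ge0 andbT leNgt; apply/negP => c0.
  have [a a0 ac] : exists2 a : R, 0 < a & (a%:E <= grid_average X g t z)%E.
    move: c0; case: (grid_average X g t z) => [a|_|//]; last by exists 1; rewrite ?leey.
    by rewrite lte_fin; exists a.
  have mGp : measurable_fun setT (fun x => grid_maximal X g x `^ p)%E.
    exact: measurableT_comp (measurable_poweR p) (measurable_grid_maximal X g).
  have Gp0 x : (0 <= grid_maximal X g x `^ p)%E by exact: poweR_ge0.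
  have e1 : ((a `^ p * (t%:num / 2) ^+ n)%:E <=
      \int[leb R n]_(x in [set x | grid_cell t x = z]) grid_maximal X g x `^ p)%E.
    apply: ge0_integral_cell_ge; [exact: mGp|exact: Gp0|exact: powR_ge0|].
    move=> x xz; apply: (@le_poweR _ p a%:E); rewrite ?lee_fin ?(ltW p0) ?(ltW a0)//.
    by apply: (le_trans ac); rewrite -xz; exact: grid_maximal_ge.
  have e2 := integral_cell_le t z _ mGp Gp0.
  have := le_trans e1 (le_trans e2 G0); rewrite lee_fin leNgt.
  by rewrite mulr_gt0 ?powR_gt0 ?exprn_gt0.
have gQ x : cube_set Q x -> g x != 0%E.
  by move=> Qx; rewrite /g indicE mem_set// eqe oner_eq0.
have B0 := bfs_norm_average_gt0 X Q g mg gQ.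
have Boo : (norm_average (bfs_norm X) Q g < +oo)%E.
  pose E := [set x : Rn R n | cube_set Q (side Q *: (x : 'rV[R]_n))].
  have mE : measurable E.
    have := measurable_dilate (side Q) s0 measurableT _ (measurable_cube Q).
    by rewrite setTI.
  rewrite /norm_average /bfs_norm.
  rewrite (_ : (fun x => _) = (fun x => (\1_E x)%:E)); last first.
    apply/funext => x; rewrite /dilation /g -EFinM !indicE -natrM mulnb andbb/=.
    by rewrite normr_nat; congr (_ %:R%:E); apply/idP/idP; rewrite !inE.
  apply: (bfn_indic (bfs_axioms X) mE).
  have := lebesgue_outer_dilation (side Q) (cube_set Q) s0.
  rewrite [LHS](leb_cube Q) => dE; rewrite ltey; apply/eqP => Eoo.
  by move: dE; rewrite [X in (_ * X)%E]Eoo gt0_muley.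
have := associate_hoelder_average X Q g g mg mg.
rewrite B0 Boo => /(_ isT); rewrite -[norm_average (associate_norm X) Q g]/(grid_average X g t z).
rewrite c0 mul0e mule0 leNgt => /negP; apply.
rewrite (eq_integral (cst 1%E)); last first.
  by move=> x xQ; rewrite /g indicE xQ mule1 abse1.
by rewrite integral_cst ?mul1e ?leb_cube ?lte_fin//; exact: measurable_cube.
Qed.

(** * The weight condition *)

Lemma weight_cube_gt0 {R : realType} {n : nat} (u : Rn R n -> R) (Q : cube R n) :
  weight u -> (0 < \int[leb R n]_(x in cube_set Q) (u x)%:E)%E.
Proof.
move=> [mu u0 _ u_gt0]; have mQ := measurable_cube Q.
rewrite lt0e integral_ge0 ?andbT => [|x _]; last by rewrite lee_fin.
apply/eqP => uQ0.
have muE : measurable_fun (cube_set Q : set (Rn R n)) (EFin \o u).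
  by apply: measurable_funTS; apply/measurable_EFinP.
have /(ae_eq_integral_abs (leb R n) mQ muE).1 uae :
    (\int[leb R n]_(x in cube_set Q) `|(EFin \o u) x| = 0)%E.
  by rewrite -uQ0; apply: eq_integral => x _; rewrite /= ger0_norm.
have [N [mN N0 QN]] : {ae leb R n, forall x, ~ cube_set Q x}.
  apply: (filterS2 _ _ uae u_gt0) => x ux0 u_gt0x Qx.
  by have := ux0 Qx; rewrite /= => -[] /eqP; rewrite gt_eqF.
have : (leb R n (cube_set Q) <= leb R n N)%E.
  by apply: le_measure; rewrite ?inE// => x Qx; apply: QN => /=; apply.
by rewrite N0 leb_cube leNgt lte_fin exprn_gt0// /side.
Qed.

Lemma measurable_weight_inv {R : realType} {n : nat} (v : Rn R n -> R) :
  weight v -> measurable_fun setT (fun x => (v x)%:E^-1)%E.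
Proof.
move=> [mv v0 _ _].
rewrite (_ : (fun x => _) = fun x => if v x == 0 then +oo%E else (v x `^ (-1))%:E).
  apply: measurable_fun_ifT.
  - exact: (@measurable_fun_eqr _ (Rn R n) R setT v (cst 0) mv (measurable_cst _)).
  - exact: measurable_cst.
  - by apply/measurable_EFinP; exact: measurableT_comp (measurable_powR (-1)) mv.
by apply/funext => x; rewrite inver powR_inv1.
Qed.

Lemma prode_gt0 {R : realType} (m : nat) (d : 'I_m -> \bar R) :
  (forall i, 0 < d i)%E -> (0 < \prod_i d i)%E.
Proof.
move=> d0; apply: (big_ind (fun x => 0 < x)%E) => [|x y|i _]; rewrite ?lte01//.
exact: mule_gt0.
Qed.

Lemma prode_lty {R : realType} (m : nat) (d : 'I_m -> \bar R) i :
  (forall i, 0 < d i)%E -> (\prod_i d i < +oo)%E -> (d i < +oo)%E.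
Proof.
move=> d0; rewrite (bigD1 i)//= !ltey; apply: contra => /eqP ->.
rewrite gt0_mulye//; apply: (big_ind (fun x => 0 < x)%E) => [|x y|j _]; rewrite ?lte01//.
exact: mule_gt0.
Qed.

(** Each factor of the weight condition on [Q] is positive, so finiteness of the
    product makes each of them a positive real number. *)
Lemma weight_constant_cube {R : realType} {n m : nat} (q : R)
    (X : 'I_m -> banach_function_space R n) (u : Rn R n -> R)
    (v : 'I_m -> Rn R n -> R) (Q : cube R n) :
  0 < q -> weight u -> (forall i, weight (v i)) ->
  (weight_constant q X u v < +oo)%E ->
  exists (U : R) (d : 'I_m -> R), [/\ 0 < U, forall i, 0 < d i,
    (\int[leb R n]_(x in cube_set Q) (u x)%:E = U%:E)%E,
    forall i, norm_average (bfs_norm (X i)) Q (fun x => (v i x)%:E^-1)%E = (d i)%:E &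
    (((U / side Q ^+ n) `^ q^-1 * \prod_i d i)%:E <= weight_constant q X u v)%E].
Proof.
move=> q0 wu wv Koo; set K := weight_constant _ _ _ _ in Koo *.
have sn0 : 0 < side Q ^+ n by rewrite exprn_gt0// /side.
have U0 := weight_cube_gt0 u Q wu.
have d0 i : (0 < norm_average (bfs_norm (X i)) Q (fun x => (v i x)%:E^-1))%E.
  apply: bfs_norm_average_gt0; first exact: measurable_weight_inv.
  move=> x _; rewrite inver; case: ifPn => // vn0.
  by rewrite eqe invr_eq0.
have : (((\int[leb R n]_(x in cube_set Q) (u x)%:E) / leb R n (cube_set Q)) `^ q^-1 *
    \prod_(i < m) norm_average (bfs_norm (X i)) Q (fun x => (v i x)%:E^-1) <= K)%E.
  by apply: ereal_sup_ubound; exists Q.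
rewrite leb_cube; set I := (\int[leb R n]_(x in _) _)%E in U0 *.
set D := fun i => norm_average (bfs_norm (X i)) Q (fun x => (v i x)%:E^-1)%E.
have D0 : (0 < \prod_(i < m) D i)%E by exact: prode_gt0.
have V0 : (0 < (side Q ^+ n)%:E^-1)%E by rewrite inver gt_eqF// lte_fin invr_gt0.
have IV0 : (0 < I / (side Q ^+ n)%:E)%E by rewrite mule_gt0.
have IVq0 : (0 < (I / (side Q ^+ n)%:E) `^ q^-1)%E by rewrite poweR_gt0.
change (((I / (side Q ^+ n)%:E) `^ q^-1 * \prod_(i < m) D i <= K)%E ->
  exists (U : R) (d : 'I_m -> R), [/\ 0 < U, forall i, 0 < d i, I = U%:E,
    forall i, D i = (d i)%:E &
    (((U / side Q ^+ n) `^ q^-1 * \prod_i d i)%:E <= K)%E]) => IDK.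
have IDoo := le_lt_trans IDK Koo.
have Doo : (\prod_(i < m) D i < +oo)%E.
  by move: IDoo; rewrite !ltey; apply: contra => /eqP ->; rewrite gt0_muley.
have IVoo : ((I / (side Q ^+ n)%:E) `^ q^-1 < +oo)%E.
  by move: IDoo; rewrite !ltey; apply: contra => /eqP ->; rewrite gt0_mulye.
have Ioo : (I < +oo)%E.
  move: IVoo; rewrite !ltey; apply: contra => /eqP ->; rewrite gt0_mulye//.
  by rewrite poweRE invr_eq0 (gt_eqF q0) eqxx.
have IE : I = (fine I)%:E by rewrite fineK// gt0_fin_numE.
have DE i : D i = (fine (D i))%:E.
  by rewrite fineK// gt0_fin_numE ?d0//; exact: prode_lty.
exists (fine I), (fun i => fine (D i)); split=> // [|i|].
- by rewrite fine_gt0// U0 Ioo.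
- by rewrite fine_gt0// d0 -/(D i) (prode_lty _ D).
- move: IDK; rewrite IE inver gt_eqF// -EFinM (eq_bigr _ (fun i _ => DE i)).
  by rewrite prodEFin -EFinM.
Qed.

(** * Fractional averages *)

Definition frac_average {R : realType} {n m : nat} (alpha : R)
    (f : 'I_m -> Rn R n -> \bar R) (Q : cube R n) : \bar R :=
  (\prod_(i < m) ((leb R n (cube_set Q) `^ (1 - alpha / (m * n)%:R))^-1 *
                  \int[leb R n]_(y in cube_set Q) `|f i y|))%E.

Lemma lee_prod {R : realType} (m : nat) (x y : 'I_m -> \bar R) :
  (forall i, 0 <= x i)%E -> (forall i, x i <= y i)%E ->
  (\prod_i x i <= \prod_i y i)%E.
Proof.
move=> x0 xy; suff /andP[] : (0 <= \prod_i x i <= \prod_i y i)%E by [].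
apply: (big_ind2 (fun a b : \bar R => 0 <= a <= b)%E) => [|a b c d|i _].
- by rewrite lee01 lexx.
- by move=> /andP[a0 ab] /andP[c0 cd]; rewrite mule_ge0// lee_pmul.
- by rewrite x0 xy.
Qed.

Lemma leb_cube_powV {R : realType} {n : nat} (Q : cube R n) (r : R) :
  ((leb R n (cube_set Q) `^ r)^-1 = (((side Q ^+ n) `^ r)^-1)%:E)%E.
Proof.
have sn0 : 0 < side Q ^+ n by rewrite exprn_gt0// /side.
by rewrite leb_cube inver gt_eqF// powR_gt0.
Qed.

Lemma abs_average_ge0 {R : realType} {n : nat} (f : Rn R n -> \bar R)
    (Q : cube R n) (r : R) :
  (0 <= (leb R n (cube_set Q) `^ r)^-1 * \int[leb R n]_(y in cube_set Q) `|f y|)%E.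
Proof.
rewrite leb_cube_powV; apply: mule_ge0; first by rewrite lee_fin invr_ge0 powR_ge0.
by apply: integral_ge0 => x _; exact: abse_ge0.
Qed.

Lemma frac_average_ge0 {R : realType} {n m : nat} (alpha : R)
    (f : 'I_m -> Rn R n -> \bar R) (Q : cube R n) : (0 <= frac_average alpha f Q)%E.
Proof. by apply: prode_ge0 => i _; exact: abs_average_ge0. Qed.

(** Enlarging [Q] changes each normalising factor by at most [6 ^ n], the bound
    for the ratio of the volumes. *)
Lemma frac_average_le {R : realType} {n m : nat} (alpha : R)
    (f : 'I_m -> Rn R n -> \bar R) (Q P : cube R n) :
  0 < alpha < (m * n)%:R -> (forall i, measurable_fun setT (f i)) ->
  cube_set Q `<=` cube_set P -> side P <= 6 * side Q ->
  (frac_average alpha f Q <= ((6 ^+ n) ^+ m)%:E * frac_average alpha f P)%E.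
Proof.
move=> /andP[alpha0 alphamn] mf QP PQ; rewrite /frac_average.
set r := 1 - _; have mn0 : 0 < (m * n)%:R :> R by exact: lt_trans alphamn.
have r0 : 0 <= r by rewrite subr_ge0 ler_pdivrMr// mul1r ltW.
have r1 : r <= 1 by rewrite gerBl divr_ge0// ltW.
have Q0 : 0 < side Q by rewrite /side.
have P0 : 0 < side P by rewrite /side.
have -> : ((6 ^+ n) ^+ m)%:E = (\prod_(i < m) (6 ^+ n)%:E)%E :> \bar R.
  by rewrite prodEFin prodr_const card_ord.
rewrite -big_split; apply: lee_prod => i.
  exact: abs_average_ge0.
change (((leb R n (cube_set Q) `^ r)^-1 * \int[leb R n]_(y in cube_set Q) `|f i y|
  <= (6 ^+ n)%:E * ((leb R n (cube_set P) `^ r)^-1 *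
     \int[leb R n]_(y in cube_set P) `|f i y|))%E).
rewrite muleA !leb_cube_powV -EFinM; apply: lee_pmul.
- by rewrite lee_fin invr_ge0 powR_ge0.
- by apply: integral_ge0 => x _; exact: abse_ge0.
- rewrite lee_fin ler_pdivlMr ?powR_gt0 ?exprn_gt0// mulrC ler_pdivrMr ?powR_gt0 ?exprn_gt0//.
  apply: (@le_trans _ _ ((6 ^+ n * side Q ^+ n) `^ r)).
    rewrite ge0_ler_powR ?nnegrE ?mulr_ge0 ?exprn_ge0 ?(ltW Q0) ?(ltW P0)//.
    by rewrite -exprMn; apply: lerXn2r; rewrite ?nnegrE ?mulr_ge0 ?(ltW P0) ?(ltW Q0).
  rewrite powRM ?exprn_ge0 ?(ltW Q0)// ler_wpM2r ?powR_ge0//.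
  by rewrite ler1_powR// exprn_ege1// ler1n.
- apply: ge0_subset_integral.
  + exact: measurable_cube.
  + exact: measurable_cube.
  + exact/measurable_funTS/measurable_fun_abs.
  + by move=> y _; exact: abse_ge0.
  + exact: QP.
Qed.

Lemma fractional_maximal_ge0 {R : realType} {n m : nat} (alpha : R)
    (f : 'I_m -> Rn R n -> \bar R) x : (0 <= fractional_maximal alpha f x)%E.
Proof.
have := frac_average_ge0 alpha f (grid_cube (dyadic true 0) (grid_cell (dyadic true 0) x)).
move=> /le_trans; apply; apply: ereal_sup_ubound.
by exists (grid_cube (dyadic true 0) (grid_cell (dyadic true 0) x)) => //; exact: grid_cube_refl.
Qed.

Definition grid_frac {R : realType} {n m : nat} (alpha q : R)
    (f : 'I_m -> Rn R n -> \bar R) (t : {posnum R}) (z : 'rV[int]_n) : \bar R :=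
  (frac_average alpha f (grid_cube t z) `^ q)%E.

(** Each cube through [x] is absorbed by the grid cube of a comparable dyadic
    scale, and the supremum over the scales is replaced by a sum. *)
Lemma fractional_maximal_le_grid {R : realType} {n m : nat} (alpha q : R)
    (f : 'I_m -> Rn R n -> \bar R) (x : Rn R n) : 0 < q ->
  0 < alpha < (m * n)%:R -> (forall i, measurable_fun setT (f i)) ->
  (fractional_maximal alpha f x `^ q <= (((6 ^+ n) ^+ m) `^ q)%:E *
    (\sum_(0 <= j <oo)
       grid_frac alpha q f (dyadic true j) (grid_cell (dyadic true j) x) +
     \sum_(0 <= j <oo)
       grid_frac alpha q f (dyadic false j) (grid_cell (dyadic false j) x)))%E.
Proof.
move=> q0 alphaP mf; have qn0 : q != 0 by rewrite gt_eqF.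
pose L t := grid_frac alpha q f t (grid_cell t x).
set S := (_ + _)%E; set C : R := (6 ^+ n) ^+ m.
have L0 t : (0 <= L t)%E by exact: poweR_ge0.
have S0 : (0 <= S)%E by apply: adde_ge0; apply: nneseries_ge0 => j _ _; exact: L0.
have LS b j : (L (dyadic b j) <= S)%E.
  have Lj : (L (dyadic b j) <= \sum_(0 <= j <oo) L (dyadic b j))%E.
    exact: (nneseries_ge_term (fun j => L (dyadic b j))).
  apply: (le_trans Lj); rewrite /S; case: (b).
    by apply: leeDl; apply: nneseries_ge0 => k _ _; exact: L0.
  by apply: leeDr; apply: nneseries_ge0 => k _ _; exact: L0.
have C0 : 0 <= C by rewrite !exprn_ge0.
have supS : (fractional_maximal alpha f x <= C%:E * S `^ q^-1)%E.
  apply: ge_ereal_sup => _ [Q Qx <-].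
  have l0 : 0 < side Q by rewrite /side.
  have [b [j /andP[lt tl]]] := exists_dyadic (side Q) l0.
  apply: (@le_trans _ _ (C%:E * frac_average alpha f
      (grid_cube (dyadic b j) (grid_cell (dyadic b j) x)))%E).
    apply: frac_average_le => //; first exact: cube_sub_grid_cube.
    by rewrite {1}/side/=; lra.
  rewrite lee_wpmul2l ?lee_fin//.
  rewrite -[leLHS]poweRe1 ?frac_average_ge0// -(divff qn0) poweRrM.
  have qV0 : 0 <= q^-1 by rewrite invr_ge0 ltW.
  exact: (le_poweR _ _ _ qV0 (L0 _) (LS b j)).
have M0 := fractional_maximal_ge0 alpha f x.
apply: (le_trans (le_poweR _ _ _ (ltW q0) M0 supS)).
rewrite poweRM ?lee_fin ?poweR_ge0// -poweRrM mulVf// poweRe1//.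
Qed.

(** The powers of the volume combine to [q * (alpha / n) + 1 = q / p]. *)
Lemma frac_average_testing {R : realType} {n m : nat} (alpha p q : R)
    (f : 'I_m -> Rn R n -> \bar R) (Q : cube R n) (K U : R) (c d : 'I_m -> R) :
  (0 < n)%N -> (0 < m)%N -> 0 < q -> q^-1 = p^-1 - alpha / n%:R ->
  0 < U -> (forall i, 0 <= c i) -> (forall i, 0 <= d i) ->
  (forall i, \int[leb R n]_(x in cube_set Q) `|f i x| <=
             (side Q ^+ n * (c i * d i))%:E)%E ->
  (U / side Q ^+ n) `^ q^-1 * \prod_i d i <= K ->
  (frac_average alpha f Q `^ q * U%:E <=
    (K `^ q * (side Q ^+ n) `^ (q / p) * (\prod_i c i) `^ q)%:E)%E.
Proof.
move=> n0 m0 q0 qE U0 c0 d0 fcd UdK; have qn0 : q != 0 by rewrite gt_eqF.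
have V0 : 0 < side Q ^+ n by rewrite exprn_gt0// /side.
set V := side Q ^+ n in V0 fcd UdK *.
have nn0 : n%:R != 0 :> R by rewrite pnatr_eq0 -lt0n.
have mm0 : m%:R != 0 :> R by rewrite pnatr_eq0 -lt0n.
have pc0 : 0 <= \prod_i c i by rewrite prodr_ge0.
have pd0 : 0 <= \prod_i d i by rewrite prodr_ge0.
have avg : (frac_average alpha f Q <=
    (V `^ (alpha / n%:R) * ((\prod_i c i) * \prod_i d i))%:E)%E.
  have -> : V `^ (alpha / n%:R) * ((\prod_i c i) * \prod_i d i) =
      \prod_(i < m) (V `^ (alpha / (m * n)%:R) * (c i * d i)).
    rewrite !big_split/= prodr_const card_ord; congr (_ * _).
    rewrite -powR_mulrn ?powR_ge0// -powRrM natrM; congr (_ `^ _).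
    by field; rewrite nn0 mm0.
  rewrite -prodEFin; apply: lee_prod => i; first exact: abs_average_ge0.
  rewrite leb_cube_powV -/V.
  apply: (@le_trans _ _ (((V `^ (1 - alpha / (m * n)%:R))^-1)%:E * (V * (c i * d i))%:E)%E).
    by rewrite lee_wpmul2l ?lee_fin ?invr_ge0 ?powR_ge0.
  rewrite -EFinM lee_fin [leLHS]mulrA ler_wpM2r ?mulr_ge0//.
  rewrite -powR_inv1 ?powR_ge0// -powRrM -{2}[V]powRr1 ?(ltW V0)//.
  rewrite -powRD; last by rewrite (gt_eqF V0) implybT.
  by rewrite mulrN1 opprB subrK.
have avg0 := frac_average_ge0 alpha f Q.
apply: (@le_trans _ _ (((V `^ (alpha / n%:R) * ((\prod_i c i) * \prod_i d i)) `^ q * U)%:E)).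
  rewrite EFinM lee_wpmul2r ?lee_fin ?(ltW U0)//.
  exact: (le_poweR q _ _ (ltW q0) avg0 avg).
have UdK' : (U / V) * (\prod_i d i) `^ q <= K `^ q.
  have UV0 : 0 <= U / V by rewrite divr_ge0 ?ltW.
  have -> : U / V = ((U / V) `^ q^-1) `^ q by rewrite -powRrM mulVf// powRr1.
  rewrite -powRM ?powR_ge0//.
  have X0 : 0 <= (U / V) `^ q^-1 * \prod_i d i by rewrite mulr_ge0 ?powR_ge0.
  by apply: ge0_ler_powR; rewrite ?nnegrE ?(ltW q0) ?(le_trans X0 UdK).
rewrite lee_fin !powRM ?mulr_ge0 ?powR_ge0//.
have -> : V `^ (q / p) = (V `^ (alpha / n%:R)) `^ q * V.
  have -> : q / p = alpha / n%:R * q + 1.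
    have -> : q / p = q * (q^-1 + alpha / n%:R) by rewrite qE subrK.
    by rewrite mulrDr divff// addrC mulrC.
  rewrite powRD; last by rewrite (gt_eqF V0) implybT.
  by rewrite powRr1 ?(ltW V0)// powRrM.
have -> : (V `^ (alpha / n%:R)) `^ q * ((\prod_i c i) `^ q * (\prod_i d i) `^ q) * U =
   (U / V * (\prod_i d i) `^ q) * ((V `^ (alpha / n%:R)) `^ q * V * (\prod_i c i) `^ q).
  by field; rewrite gt_eqF.
by rewrite -[leRHS]mulrA ler_wpM2r ?mulr_ge0 ?powR_ge0 ?(ltW V0).
Qed.

(** * The integrable majorant *)

(** Write [f = (f * v) / v], which holds where [v > 0], and apply the duality of
    [X] and [X']. *)
Lemma integral_abs_le_averages {R : realType} {n : nat}
    (X : banach_function_space R n) (v : Rn R n -> R) (f : Rn R n -> \bar R)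
    (Q : cube R n) (c d : R) :
  weight v -> measurable_fun setT f -> 0 < d ->
  norm_average (bfs_norm X) Q (fun x => (v x)%:E^-1)%E = d%:E ->
  norm_average (associate_norm X) Q (fun x => f x * (v x)%:E)%E = c%:E ->
  (\int[leb R n]_(x in cube_set Q) `|f x| <= (side Q ^+ n * (c * d))%:E)%E.
Proof.
move=> wv mf d0 dE cE; have mV := measurable_weight_inv v wv.
have mg : measurable_fun setT (fun x => f x * (v x)%:E)%E.
  apply: emeasurable_funM; first exact: mf.
  by apply/measurable_EFinP; case: wv.
have := associate_hoelder_average X Q _ _ mg mV.
rewrite dE cE lte_fin d0 ltry => /(_ isT); rewrite -!EFinM.
congr (_ <= _)%E; apply: ge0_ae_eq_integral.
- exact: measurable_cube.
- exact/measurable_funTS/measurable_fun_abs/(emeasurable_funM mg mV).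
- exact/measurable_funTS/measurable_fun_abs.
- by move=> x _; exact: abse_ge0.
- by move=> x _; exact: abse_ge0.
case: wv => _ _ _; apply: filterS => x vx _.
by rewrite -muleA inver gt_eqF// -EFinM divff ?gt_eqF// mule1.
Qed.

Lemma weighted_LnormE {R : realType} {n : nat} (p : R) (v : Rn R n -> R)
    (f : Rn R n -> \bar R) : 0 < p -> (forall x, 0 <= v x) ->
  weighted_Lnorm p (fun x => v x `^ p) f =
  ('N[leb R n]_p%:E[(fun x => f x * (v x)%:E)])%E.
Proof.
move=> p0 v0; have pn0 : p != 0 by rewrite gt_eqF.
rewrite -[RHS]poweRe1 ?Lnorm_ge0// -(divff pn0) poweRrM poweR_Lnorm//.
congr (_ `^ _)%E; apply: eq_integral => x _.
by rewrite abseM poweRM ?abse_ge0// [X in _ = (_ * (X `^ _))%E]gee0_abs ?lee_fin.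
Qed.

(** An infinite average would make the maximal function infinite on a whole
    cell. *)
Lemma grid_average_fin_num {R : realType} {n : nat}
    (X : banach_function_space R n) g (p B : R) b j z : 0 < p ->
  (\int[leb R n]_x grid_maximal X g x `^ p <= B%:E)%E ->
  grid_average X g (dyadic b j) z \is a fin_num.
Proof.
move=> p0 GB; rewrite ge0_fin_numE ?grid_average_ge0// ltey; apply/eqP => coo.
set t := dyadic b j in coo.
have t0 : 0 < (t%:num / 2) ^+ n by rewrite exprn_gt0.
(* a height whose mass on the cell exceeds [B] *)
pose a := (`|B| + 1) / (t%:num / 2) ^+ n.
have mGp : measurable_fun setT (fun x => grid_maximal X g x `^ p)%E.
  exact: measurableT_comp (measurable_poweR p) (measurable_grid_maximal X g).
have Gp0 x : (0 <= grid_maximal X g x `^ p)%E by exact: poweR_ge0.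
have a0 : 0 <= a by rewrite divr_ge0 ?addr_ge0// ltW.
have e1 : ((a * (t%:num / 2) ^+ n)%:E <=
    \int[leb R n]_(x in [set x | grid_cell t x = z]) grid_maximal X g x `^ p)%E.
  apply: ge0_integral_cell_ge; [exact: mGp|exact: Gp0|exact: a0|].
  move=> x xz; have := grid_maximal_ge X g b j x.
  rewrite -/t xz coo leye_eq => /eqP ->.
  by rewrite poweRE (gt_eqF p0) eqxx leey.
have e2 := integral_cell_le t z _ mGp Gp0.
have := le_trans e1 (le_trans e2 GB); rewrite lee_fin divfK ?gt_eqF//.
by have := ler_norm B; lra.
Qed.

(** With [w i = p / p_ i], which sum to [1], AM-GM bounds
    [\prod_i (G i / B i) ^ p] by [\sum_i w i * (G i / B i) ^ p_ i], where [G i] is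
    the maximal function of [g i]; the integral of this sum is at most
    [\sum_i w i = 1].  It plays the part of the Hoelder inequality for [m]
    functions, but yields a single integrable majorant. *)
Lemma grid_average_majorant {R : realType} {n m : nat}
    (X : 'I_m -> banach_function_space R n) (g : 'I_m -> Rn R n -> \bar R)
    (p : R) (p_ B : 'I_m -> R) :
  0 < p -> (forall i, 0 < p_ i) -> p^-1 = \sum_i (p_ i)^-1 ->
  (forall i, 0 < B i) ->
  (forall i, \int[leb R n]_x grid_maximal (X i) (g i) x `^ p_ i <=
             (B i `^ p_ i)%:E)%E ->
  exists H : Rn R n -> \bar R, [/\ measurable_fun setT H,
    forall x, (0 <= H x)%E, (\int[leb R n]_x H x <= 1)%E &
    forall b j x, ((\prod_i ((fine (grid_average (X i) (g i) (dyadic b j)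
      (grid_cell (dyadic b j) x)) / B i) `^ p))%:E <= H x)%E].
Proof.
move=> p0 pi0 pE B0 GB.
pose w i := p / p_ i; have w0 i : 0 < w i by rewrite divr_gt0.
have w1 : \sum_i w i = 1 by rewrite -mulr_sumr -pE divff// gt_eqF.
have wB0 i : 0 <= w i / B i `^ p_ i by rewrite divr_ge0 ?powR_ge0// ltW.
pose h i (x : Rn R n) := ((w i / B i `^ p_ i)%:E * grid_maximal (X i) (g i) x `^ p_ i)%E.
have mGp i : measurable_fun setT (fun x => grid_maximal (X i) (g i) x `^ p_ i)%E.
  exact: measurableT_comp (measurable_poweR (p_ i)) (measurable_grid_maximal _ _).
have mh i : measurable_fun setT (h i) := measurable_funeM (w i / B i `^ p_ i)%:E (mGp i).
have h0 i x : (0 <= h i x)%E by apply: mule_ge0; rewrite ?lee_fin ?poweR_ge0.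
exists (fun x => \sum_(i < m) h i x)%E; split.
- exact: emeasurable_sum.
- by move=> x; apply: sume_ge0 => i _; exact: h0.
- rewrite ge0_integral_sum; [|exact: measurableT|exact: mh|by move=> i x _; exact: h0].
  have -> : 1%E = (\sum_(i < m) (w i)%:E)%E :> \bar R by rewrite sumEFin w1.
  apply: lee_sum => i _; rewrite ge0_integralZl.
  + apply: (@le_trans _ _ ((w i / B i `^ p_ i)%:E * (B i `^ p_ i)%:E)%E).
      by rewrite lee_wpmul2l// lee_fin.
    by rewrite -EFinM divfK// gt_eqF// powR_gt0.
  + exact: measurableT.
  + exact: mGp.
  + by move=> x _; exact: poweR_ge0.
  + by rewrite lee_fin.
move=> b j x; pose c i := fine (grid_average (X i) (g i) (dyadic b j)
  (grid_cell (dyadic b j) x)).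
have cE i : grid_average (X i) (g i) (dyadic b j) (grid_cell (dyadic b j) x) = (c i)%:E.
  by rewrite fineK//; exact: grid_average_fin_num (pi0 i) (GB i).
have c0 i : 0 <= c i by rewrite fine_ge0// grid_average_ge0.
have cB0 i : 0 <= c i / B i by rewrite divr_ge0// ltW.
apply: (@le_trans _ _ (\sum_(i < m) (w i * (c i / B i) `^ p_ i)%:E)%E).
  rewrite sumEFin lee_fin.
  apply: le_trans (weighted_AM_GM m w _ w0 w1 (fun i => powR_ge0 _ _)).
  rewrite le_eqVlt; apply/orP; left; apply/eqP/eq_bigr => i _.
  by rewrite -powRrM; congr (_ `^ _); rewrite /w mulrC divfK ?gt_eqF.
apply: lee_sum => i _; have Bi0 := ltW (B0 i).
have BV : (B i)^-1 `^ p_ i = (B i `^ p_ i)^-1.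
  by rewrite -powR_inv1// -powRrM mulN1r powRN.
rewrite powRM ?invr_ge0// BV.
have cG : ((c i `^ p_ i)%:E <= grid_maximal (X i) (g i) x `^ p_ i)%E.
  apply: (le_poweR (p_ i) (c i)%:E); rewrite ?lee_fin ?(ltW (pi0 i))// -cE.
  exact: grid_maximal_ge.
apply: le_trans (lee_wpmul2l _ cG); last by rewrite lee_fin.
by rewrite -EFinM lee_fin le_eqVlt; apply/orP; left; apply/eqP; ring.
Qed.

(** * The two-weight inequality *)

(** The theorem in the case where all quantities are positive real numbers, with
    [B i] a bound for the norm of the grid maximal function. *)
Lemma fractional_maximal_integral_le {R : realType} (n m : nat) (alpha p q : R)
    (p_ : 'I_m -> R) : (0 < n)%N -> (0 < m)%N -> 0 < alpha < (m * n)%:R ->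
  0 < p -> 0 < q -> (forall i, 0 < p_ i) ->
  p^-1 = \sum_i (p_ i)^-1 -> q^-1 = p^-1 - alpha / n%:R ->
  exists2 C : R, 0 < C &
    forall (X : 'I_m -> banach_function_space R n) (u : Rn R n -> R)
      (v : 'I_m -> Rn R n -> R) (f : 'I_m -> Rn R n -> \bar R) (K : R) (B : 'I_m -> R),
    weight u -> (forall i, weight (v i)) -> (forall i, measurable_fun setT (f i)) ->
    weight_constant q X u v = K%:E -> (forall i, 0 < B i) ->
    (forall i, \int[leb R n]_x
       grid_maximal (X i) (fun x => f i x * (v i x)%:E)%E x `^ p_ i <=
       (B i `^ p_ i)%:E)%E ->
    (\int[leb R n]_x (`|fractional_maximal alpha f x| `^ q * (u x)%:E) <=
      (C * (K * \prod_i B i) `^ q)%:E)%E.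
Proof.
move=> n0 m0 alphaP p0 q0 pi0 pE qE.
have alpha0 : 0 < alpha by case/andP: alphaP.
have qn0 : q != 0 by rewrite gt_eqF.
pose s := q / p.
have s1 : 1 < s.
  (* [q > p] because [alpha > 0] *)
  rewrite /s ltr_pdivlMr// mul1r -ltf_pV2 ?posrE// qE gtrBl divr_gt0// ltr0n//.
have [C1 C10 packing] := grid_packing n s n0 s1.
pose C0 : R := ((6 ^+ n) ^+ m) `^ q.
have C00 : 0 < C0 by rewrite powR_gt0// !exprn_gt0.
pose C6 : R := (6 ^+ n) `^ s.
have C60 : 0 < C6 by rewrite powR_gt0// exprn_gt0.
exists (C0 * C6 * (C1 + C1)); first by rewrite !mulr_gt0// addr_gt0.
move=> X u v f K B wu wv mf KE B0 GB.
have Koo : (weight_constant q X u v < +oo)%E by rewrite KE ltry.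
have K0 : 0 < K.
  have [U [d [U0 d0 _ _]]] :=
    weight_constant_cube q X u v (grid_cube (dyadic true 0) 0) q0 wu wv Koo.
  rewrite KE lee_fin; apply: lt_le_trans; rewrite mulr_gt0 ?powR_gt0//.
    by rewrite divr_gt0// exprn_gt0// /side.
  by apply: prodr_gt0 => i _.
have mu : measurable_fun setT (fun x => (u x)%:E).
  by apply/measurable_EFinP; case: wu.
have u0 x : 0 <= u x by case: wu => _ + _ _; exact.
pose g i x := (f i x * (v i x)%:E)%E.
have [H [mH H0 H1 cH]] := grid_average_majorant X g p p_ B p0 pi0 pE B0 GB.
pose cf i t z := fine (grid_average (X i) (g i) t z).
have cf0 i t z : 0 <= cf i t z by rewrite fine_ge0// grid_average_ge0.
pose c t z := \prod_i ((cf i t z / B i) `^ p).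
have BP0 : 0 < \prod_i B i by apply: prodr_gt0.
pose D : R := C6 * (K * \prod_i B i) `^ q.
have D0 : 0 < D by rewrite mulr_gt0 ?powR_gt0 ?mulr_gt0.
(* normalised as required by [packing] *)
pose L t z := (D^-1%:E * grid_frac alpha q f t z)%E.
have L0 t z : (0 <= L t z)%E.
  by apply: mule_ge0; [rewrite lee_fin invr_ge0 ltW|exact: poweR_ge0].
have testing b j z : (L (dyadic b j) z *
    \int[leb R n]_(x in [set x | grid_cell (dyadic b j) x = z]) (u x)%:E <=
    ((((dyadic b j)%:num / 2) ^+ n) `^ s * c (dyadic b j) z `^ s)%:E)%E.
  set t := dyadic b j; pose Q : cube R n := grid_cube t z.
  have [U [d [U0 d0 UE dE UdK]]] := weight_constant_cube q X u v Q q0 wu wv Koo.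
  have cE i : grid_average (X i) (g i) t z = (cf i t z)%:E.
    by rewrite fineK//; exact: grid_average_fin_num (pi0 i) (GB i).
  have fcd i : (\int[leb R n]_(x in cube_set Q) `|f i x| <=
      (side Q ^+ n * (cf i t z * d i))%:E)%E.
    exact: (integral_abs_le_averages (X i) (v i) (f i) Q _ _ (wv i) (mf i) (d0 i)
      (dE i) (cE i)).
  have UdK' : (U / side Q ^+ n) `^ q^-1 * \prod_i d i <= K.
    by rewrite -lee_fin -KE.
  have := frac_average_testing alpha p q f Q K U (fun i => cf i t z) d n0 m0 q0 qE U0
    (fun i => cf0 i t z) (fun i => ltW (d0 i)) fcd UdK'.
  rewrite -/s => test.
  have uU : (\int[leb R n]_(x in [set x | grid_cell t x = z]) (u x)%:E <= U%:E)%E.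
    rewrite -UE; apply: ge0_subset_integral.
    - exact: measurable_grid_cell.
    - exact: measurable_cube.
    - exact: measurable_funTS.
    - by move=> x _; rewrite lee_fin.
    - by move=> x xz; rewrite /Q -xz; exact: grid_cube_refl.
  apply: (@le_trans _ _ (L t z * U%:E)%E); first by rewrite lee_wpmul2l.
  rewrite /L -muleA lee_pdivrMl//; apply: (le_trans test).
  rewrite -EFinM lee_fin le_eqVlt; apply/orP; left; apply/eqP.
  have -> : (side Q ^+ n) `^ s = C6 * ((t%:num / 2) ^+ n) `^ s.
    rewrite -powRM ?exprn_ge0// -exprMn; congr ((_ ^+ _) `^ _).
    by rewrite /side/=; lra.
  have -> : (\prod_i cf i t z) `^ q = (\prod_i B i) `^ q * c t z `^ s.
    have cB0 i : 0 <= cf i t z / B i by rewrite divr_ge0// ltW.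
    rewrite /c powR_prod// -powRrM [p * _]mulrC divfK ?gt_eqF//.
    rewrite -powRM ?(ltW BP0) ?prodr_ge0// -big_split; congr (_ `^ _).
    by apply: eq_bigr => i _; rewrite /= mulrC divfK// gt_eqF.
  rewrite /D powRM ?(ltW K0) ?(ltW BP0)//.
  ring.
pose T b (x : Rn R n) := (\sum_(0 <= j <oo)
  L (dyadic b j) (grid_cell (dyadic b j) x) * (u x)%:E)%E.
have mT b : measurable_fun setT (T b).
  apply: ge0_emeasurable_sum => [j x _ _|j _].
    by apply: mule_ge0; rewrite ?lee_fin.
  by apply: emeasurable_funM; [exact: measurable_grid_step|exact: mu].
have T0 b x : (0 <= T b x)%E.
  by apply: nneseries_ge0 => j _ _; apply: mule_ge0; rewrite ?lee_fin.
have TC b : (\int[leb R n]_x T b x <= C1%:E)%E.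
  apply: (packing b c L (fun x => (u x)%:E) H) => //.
    by move=> t z; apply: prodr_ge0 => i _; exact: powR_ge0.
  by move=> j x; exact: cH.
have C0D : 0 <= C0 * D by rewrite mulr_ge0 ?ltW.
apply: (@le_trans _ _ (\int[leb R n]_x ((C0 * D)%:E * (T true x + T false x)))%E).
  apply: ge0_le_integral_nomeas => x.
    by apply: mule_ge0; rewrite ?poweR_ge0 ?lee_fin.
  rewrite gee0_abs ?fractional_maximal_ge0//.
  have TE b : (T b x = (D^-1 * u x)%:E * \sum_(0 <= j <oo)
      grid_frac alpha q f (dyadic b j) (grid_cell (dyadic b j) x))%E.
    rewrite -nneseriesZl => [|j _]; last exact: poweR_ge0.
    by apply: eq_eseriesr => j _; rewrite /L muleAC -EFinM.
  rewrite !TE -ge0_muleDr; [|by apply: nneseries_ge0 => j _ _; exact: poweR_ge0..].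
  have := fractional_maximal_le_grid alpha q f x q0 alphaP mf.
  rewrite -/C0; set S := (\sum_(0 <= j <oo) _ + _)%E => MS.
  rewrite muleA -EFinM.
  have -> : C0 * D * (D^-1 * u x) = u x * C0 by field; rewrite gt_eqF.
  by rewrite muleC EFinM -muleA lee_wpmul2l// lee_fin.
rewrite ge0_integralZl; last 4 first.
- exact: measurableT.
- by apply: emeasurable_funD; exact: mT.
- by move=> x _; rewrite adde_ge0.
- by rewrite lee_fin.
rewrite ge0_integralD; last 5 first.
- exact: measurableT.
- by move=> x _; exact: T0.
- exact: mT.
- by move=> x _; exact: T0.
- exact: mT.
apply: (@le_trans _ _ ((C0 * D)%:E * (C1%:E + C1%:E))%E).
  by rewrite lee_wpmul2l ?lee_fin// leeD.
by rewrite -EFinD -EFinM lee_fin le_eqVlt; apply/orP; left; apply/eqP; rewrite /D; ring.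
Qed.

(** If one of the norms on the right vanishes then that function is zero almost
    everywhere, and every average contains its integral as a factor. *)
Lemma fractional_maximal_eq0 {R : realType} {n m : nat} (alpha p : R)
    (f : 'I_m -> Rn R n -> \bar R) (v : Rn R n -> R) (i : 'I_m) x : 0 < p ->
  weight v -> measurable_fun setT (f i) ->
  weighted_Lnorm p (fun x => v x `^ p) (f i) = 0%E ->
  fractional_maximal alpha f x = 0%E.
Proof.
move=> p0 wv mf; have v0 y : 0 <= v y by case: wv => _ + _ _; exact.
have mg : measurable_fun setT (fun y => f i y * (v y)%:E)%E.
  apply: emeasurable_funM; first exact: mf.
  by apply/measurable_EFinP; case: wv.
rewrite (weighted_LnormE p v _ p0 v0) => /(Lnorm_eq0_eq0 mg) g0.
have {g0}f0 : {ae leb R n, forall y, f i y = 0%E}.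
  have := g0 _; rewrite lte_fin => /(_ p0) g0'.
  case: wv => _ _ _; apply: filterS2 g0' => y fv0 vy.
  have := fv0 I => /eqP; rewrite mule_eq0 => /orP[/eqP //|].
  by rewrite eqe gt_eqF.
have frac0 (Q : cube R n) : frac_average alpha f Q = 0%E.
  rewrite /frac_average (bigD1 i)//=.
  rewrite [X in (_ * X * _)%E](_ : _ = 0%E) ?mule0 ?mul0e//.
  apply/(ae_eq_integral_abs (leb R n) (measurable_cube Q) (measurable_funTS mf)).
  by apply: filterS f0 => y fy _.
apply/eqP; rewrite eq_le fractional_maximal_ge0 andbT.
by apply: ge_ereal_sup => _ [Q _ <-]; rewrite -/(frac_average alpha f Q) frac0.
Qed.

Theorem theorem1p6 (R : realType) (n m : nat) (n_ge1 : (1 <= n)%N)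
  (m_ge1 : (1 <= m)%N) (alpha : R) (p_ : 'I_m -> R) (p q : R)
  (alpha_bounds : 0 < alpha < (m * n)%:R)
  (p_gt1 : forall i, 1 < p_ i)
  (p_def : p^-1 = \sum_(i < m) (p_ i)^-1)
  (p_bounds : m%:R^-1 < p < n%:R / alpha)
  (q_def : q^-1 = p^-1 - alpha / n%:R) :
  exists2 C : R, 0 < C &
    forall X : 'I_m -> banach_function_space R n,
    (forall i, Lp_bounded (p_ i) (norm_maximal (associate_norm (X i)))) ->
    forall (u : Rn R n -> R) (v : 'I_m -> Rn R n -> R),
    weight u -> (forall i, weight (v i)) ->
    (weight_constant q X u v < +oo)%E ->
    forall f : 'I_m -> Rn R n -> \bar R,
    (forall i, measurable_fun setT (f i)) ->
    (weighted_Lnorm q u (fractional_maximal alpha f) <=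
      C%:E * weight_constant q X u v *
      \prod_(i < m)
        (Lp_opnorm (p_ i) (norm_maximal (associate_norm (X i))) *
         weighted_Lnorm (p_ i) (fun x => v i x `^ p_ i)%R (f i)))%E.
Proof.
have pi0 i : 0 < p_ i by apply: lt_trans (p_gt1 i).
have alpha0 : 0 < alpha by case/andP: alpha_bounds.
have nR0 : 0 < n%:R :> R by rewrite ltr0n.
have p0 : 0 < p.
  by case/andP: p_bounds => + _; apply: le_lt_trans; rewrite invr_ge0.
have q0 : 0 < q.
  rewrite -invr_gt0 q_def subr_gt0 -[ltLHS]invrK invf_div ltf_pV2 ?posrE ?divr_gt0//.
  by case/andP: p_bounds.
have qn0 : q != 0 by rewrite gt_eqF.
have [C C0 main] := fractional_maximal_integral_le n m alpha p q p_ n_ge1 m_ge1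
  alpha_bounds p0 q0 pi0 p_def q_def.
exists (C `^ q^-1); first by rewrite powR_gt0.
move=> X _ u v wu wv Koo f mf.
set M := fun i => norm_maximal (associate_norm (X i)).
set N := fun i => weighted_Lnorm (p_ i) (fun x => v i x `^ p_ i)%R (f i).
have [U [d [U0 d0 _ _ UdK]]] :=
  weight_constant_cube q X u v (grid_cube (dyadic true 0) 0) q0 wu wv Koo.
have K0 : (0 < weight_constant q X u v)%E.
  apply: lt_le_trans UdK; rewrite lte_fin mulr_gt0 ?powR_gt0//.
    by rewrite divr_gt0// exprn_gt0// /side.
  by apply: prodr_gt0 => i _.
have N0 i : (0 <= N i)%E by exact: poweR_ge0.
have op0 i : (0 < Lp_opnorm (p_ i) (M i))%E by exact: Lp_opnorm_gt0.
have CK0 : (0 < (C `^ q^-1)%:E * weight_constant q X u v)%E.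
  by rewrite mule_gt0// lte_fin powR_gt0.
have rhs0 : (0 <= (C `^ q^-1)%:E * weight_constant q X u v *
    \prod_(i < m) (Lp_opnorm (p_ i) (M i) * N i))%E.
  by rewrite mule_ge0 ?(ltW CK0)//; apply: prode_ge0 => i _; rewrite mule_ge0// ltW.
(* a vanishing norm makes the left side vanish, whatever the other norms are *)
have [[i Ni0]|Nn0] := pselect (exists i, N i = 0%E).
  rewrite /weighted_Lnorm integral0_eq ?poweR0r ?invr_eq0//.
  move=> x _; rewrite (fractional_maximal_eq0 alpha (p_ i) f (v i) i)//.
  by rewrite abse0 poweR0r ?mul0e.
have {}N0 i : (0 < N i)%E.
  by rewrite lt0e N0 andbT; apply/eqP => Ni; apply: Nn0; exists i.
have opN0 i : (0 < Lp_opnorm (p_ i) (M i) * N i)%E by rewrite mule_gt0.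
(* all factors on the right are positive, so an infinite one makes the product
   infinite *)
have [Poo|Poo] := eqVneq (\prod_(i < m) (Lp_opnorm (p_ i) (M i) * N i))%E +oo%E.
  by rewrite Poo gt0_muley ?leey.
have opNoo i : (Lp_opnorm (p_ i) (M i) * N i < +oo)%E.
  by apply: (prode_lty m (fun i => Lp_opnorm (p_ i) (M i) * N i)%E) => //; rewrite ltey.
pose B i := fine (Lp_opnorm (p_ i) (M i) * N i)%E.
have BE i : (Lp_opnorm (p_ i) (M i) * N i)%E = (B i)%:E.
  by rewrite fineK// gt0_fin_numE.
have B0 i : 0 < B i by rewrite fine_gt0// opN0 opNoo.
have KE : weight_constant q X u v = (fine (weight_constant q X u v))%:E.
  by rewrite fineK// gt0_fin_numE.
set K := fine _ in KE.
have v0 i x : 0 <= v i x by case: (wv i) => _ + _ _; exact.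
have Noo i : (N i < +oo)%E.
  by move: (opNoo i); rewrite !ltey; apply: contra => /eqP ->; rewrite gt0_muley.
have GB i : (\int[leb R n]_x
    grid_maximal (X i) (fun x => f i x * (v i x)%:E)%E x `^ p_ i <=
    (B i `^ p_ i)%:E)%E.
  have mg : measurable_fun setT (fun x => f i x * (v i x)%:E)%E.
    apply: emeasurable_funM; first exact: mf.
    by apply/measurable_EFinP; case: (wv i).
  have NE : N i = ('N[leb R n]_(p_ i)%:E[(fun x => f i x * (v i x)%:E)])%E.
    exact: weighted_LnormE.
  have := grid_maximal_Lp (X i) (p_ i) _ (pi0 i) mg.
  by rewrite -NE N0 Noo => /(_ isT); rewrite BE.
have K0' : 0 < K by rewrite fine_gt0// K0 Koo.
have BP0 : 0 < \prod_i B i by apply: prodr_gt0.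
have Mle := main X u v f K B wu wv mf KE B0 GB.
have qV0 : 0 <= q^-1 by rewrite invr_ge0 ltW.
have I0 : (0 <= \int[leb R n]_x (`|fractional_maximal alpha f x| `^ q * (u x)%:E))%E.
  apply: integral_ge0 => x _; apply: mule_ge0; first exact: poweR_ge0.
  by case: wu => _ u0 _ _; rewrite lee_fin.
apply: (le_trans (le_poweR _ _ _ qV0 I0 Mle)).
rewrite KE (eq_bigr _ (fun i _ => BE i)) prodEFin -!EFinM lee_fin.
have KB0 : 0 <= K * \prod_i B i by rewrite mulr_ge0 ?ltW.
rewrite powRM ?powR_ge0 ?(ltW C0)// -powRrM divff// powRr1//.
by rewrite mulrA.
Qed.
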